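(* Let $G$ be a non-bipartite and connected $d$-regular graph on $n$ vertices, for some $d\geq 3$, let $\rho$ and $\widetilde{\rho}$ denote the mixing rates of the simple and non-backtracking random walks on $G$, respectively, and let $\lambda$ be the second largest eigenvalue of $G$ in absolute value. (1) If $\lambda\geq 2\sqrt{d-1}$, then $$\frac{d}{2(d-1)}\leq\frac{\widetilde{\rho}}{\rho}\leq 1.$$ (2) If $\lambda<2\sqrt{d-1}$ and $d=n^{o(1)}$, then $$\frac{\widetilde{\rho}}{\rho}=\frac{d}{2(d-1)}+o(1),$$ where the $o(1)$-term tends to $0$ as $n\to\infty$. That is: for every sequence $(G_i)$ of connected non-bipartite $d_i$-regular graphs on $n_i$ vertices with $d_i\geq 3$, $n_i\to\infty$, $\frac{\log d_i}{\log n_i}\to 0$, and $\lambda(G_i)<2\sqrt{d_i-1}$ for all $i$, one has $\frac{\widetilde{\rho}(G_i)}{\rho(G_i)}-\frac{d_i}{2(d_i-1)}\to 0$.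
   Context: Graphs are finite, undirected and simple. For a $d$-regular graph $G=(V,E)$ on $n$ vertices with adjacency eigenvalues $d=\lambda_1\geq\lambda_2\geq\dots\geq\lambda_n$, the second largest eigenvalue in absolute value is $\lambda=\lambda(G)=\max\{\lambda_2,|\lambda_n|\}$. The simple random walk on $G$ moves at each step to a uniformly chosen neighbor of the current vertex; $P^{(k)}_{uv}$ is the probability that it is at $v$ after $k$ steps when started at $u$. A non-backtracking random walk of length $k$ on $G$ from a vertex $w_0$ is a uniformly chosen member of the set of sequences $(w_0,w_1,\dots,w_k)$ of vertices with $w_{t-1}w_t\in E$ for all $1\leq t\leq k$ and $w_{t-1}\neq w_{t+1}$ for all $1\leq t\leq k-1$; $\widetilde{P}^{(k)}_{uv}$ is the probability that such a walk of length $k$ started at $u$ ends at $v$. The mixing rates are $$\rho(G)=\limsup_{k\to\infty}\max_{u,v\in V}\left|P^{(k)}_{uv}-\frac1n\right|^{1/k},\qquad \widetilde{\rho}(G)=\limsup_{k\to\infty}\max_{u,v\in V}\left|\widetilde{P}^{(k)}_{uv}-\frac1n\right|^{1/k}.$$ *)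

(* Defs.v *)
From HB Require Import structures.
From mathcomp Require Export all_boot all_order all_algebra.
From mathcomp Require Export all_classical all_reals all_analysis.
From mathcomp Require Import spectral sesquilinear complex.

Set Implicit Arguments.
Unset Strict Implicit.
Unset Printing Implicit Defensive.

Import Order.TTheory GRing.Theory Num.Theory.
Import numFieldNormedType.Exports.

Local Open Scope classical_set_scope.
Local Open Scope ring_scope.

Record sgraph := SGraph {
  svertex :> finType;
  adj : rel svertex;
  adj_sym : symmetric adj;
  adj_irrefl : irreflexive adj }.

Definition neighbors (G : sgraph) (x : G) : {set G} := [set y | adj x y].

Definition regular (d : nat) (G : sgraph) : Prop :=
  forall x : G, #|neighbors x| = d.

Definition connected (G : sgraph) : Prop :=
  (0 < #|G|)%N /\ forall x y : G, connect (@adj G) x y.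

Definition bipartite (G : sgraph) : Prop :=
  exists c : G -> bool, forall x y : G, adj x y -> c x != c y.

Section Spectrum.
Variables (R : realType) (G : sgraph).

Definition adjacency_mx : 'M[R]_#|G| :=
  \matrix_(i, j) (adj (enum_val i) (enum_val j))%:R.

(* Eigenvalues are listed with multiplicity, in nonincreasing order. *)
Definition is_spectrum (s : seq R) : Prop :=
  sorted >=%R s /\ char_poly adjacency_mx = \prod_(a <- s) ('X - a%:P).

(* The default [::] is never used: see spectrumP. *)
Definition spectrum : seq R := xget [::] [set s | is_spectrum s].

Lemma spectrumP : is_spectrum spectrum.
Proof.
rewrite /spectrum; apply: xgetPex.
set A := adjacency_mx.
pose f : {rmorphism R -> R[i]} := real_complex R.
have Asym : A^T = A by apply/matrixP => i j; rewrite !mxE adj_sym.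
pose B := map_mx f A.
have Bh : B \is hermsymmx.
  apply: realsym_hermsym.
    apply/is_hermitianmxP; rewrite expr0 scale1r map_mx_id //.
    by rewrite /B map_trmx Asym.
  by apply/mxOverP => i j; rewrite !mxE rmorph_nat realn.
have Dr := hermitian_spectral_diag_real Bh.
have /hermitian_normalmx /orthomx_spectralP := Bh.
set P := spectralmx B in Dr *; set D := spectral_diag B in Dr * => BE.
have uP : P \in unitmx by exact: spectral_unit.
have cB : char_poly B = \prod_(i < #|G|) ('X - (D 0 i)%:P).
  transitivity (char_poly (diag_mx D)); last first.
    rewrite char_poly_trig ?diag_mx_is_trig //.
    by apply: eq_bigr => i _; rewrite mxE eqxx mulr1n.
  have cE : char_poly_mx B = map_mx polyC (invmx P)
      *m char_poly_mx (diag_mx D) *m map_mx polyC P.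
    rewrite /char_poly_mx [in LHS]BE !map_mxM mulmxBr mulmxBl; congr (_ - _).
    by rewrite scalar_mxC -mulmxA -map_mxM mulVmx // map_mx1 mulmx1.
  rewrite /char_poly cE !det_mulmx mulrAC -det_mulmx -map_mxM mulVmx //.
  by rewrite map_mx1 det1 mul1r.
pose s := [seq complex.Re (D 0 i) | i <- index_enum 'I_#|G|].
exists (sort >=%R s); split; first by apply: sort_sorted => x y; exact: le_total.
rewrite (perm_big _ (permEl (perm_sort _ _))) /= big_map.
apply: (map_poly_inj f); rewrite map_char_poly -/B cB rmorph_prod.
apply: eq_bigr => i _; rewrite rmorphB /= map_polyX map_polyC /=.
congr ('X - _%:P); have /mxOverP/(_ 0 i) := Dr.
by move/RRe_real.
Qed.

(* As spectrum is indexed from 0, \lambda_2 and \lambda_n are at 1 and n.-1. *)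
Definition second_eigenvalue : R :=
  Num.max spectrum`_1 `|spectrum`_(#|G|.-1)|.

End Spectrum.

Section RandomWalks.
Variables (R : realType) (G : sgraph).

Fixpoint srw_prob (k : nat) (u v : G) : R :=
  if k is k'.+1 then
    \sum_(w : G) srw_prob k' u w * ((adj w v)%:R / #|neighbors w|%:R)
  else (u == v)%:R.

(* The default value u of nth is never used: all indices are at most k. *)
Definition nb_walks (k : nat) (u : G) : {set k.+1.-tuple G} :=
  [set w : k.+1.-tuple G |
    [&& nth u w 0 == u,
        [forall t : 'I_k, adj (nth u w t) (nth u w t.+1)] &
        [forall t : 'I_k.-1, nth u w t != nth u w t.+2]]].

Definition nbrw_prob (k : nat) (u v : G) : R :=
  #|[set w in nb_walks k u | nth u w k == v]|%:R / #|nb_walks k u|%:R.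

Definition mixing_rate (P : nat -> G -> G -> R) : R :=
  limn_sup (fun k : nat =>
    \big[Num.max/0]_(u : G) \big[Num.max/0]_(v : G)
      (`|P k u v - #|G|%:R^-1| `^ k%:R^-1)).

Definition srw_mixing_rate : R := mixing_rate srw_prob.

Definition nbrw_mixing_rate : R := mixing_rate nbrw_prob.

End RandomWalks.

(* Main.v *)
Require Import Defs.
From mathcomp Require Import spectral sesquilinear complex.
From mathcomp Require Import ring lra zify.

(** Write [q = d - 1] and [lam] for the second largest eigenvalue in absolute
    value.  Both walks have
    kernels that are polynomials in the adjacency matrix: [(A / d) ^ k] for the
    simple walk, and [g_k(A) / g_k(d)] for the non-backtracking one, where
    [g_{k+1}(x) = x g_k(x) - q g_{k-1}(x)] for [k >= 2] (a walk extended by one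
    edge either stays non-backtracking or returns along its last edge).  The
    deviation from uniformity is therefore governed, up to constants that do not
    depend on [k], by the values of these polynomials at the eigenvalues other
    than [d]; constants do not affect the mixing rates, so it is enough to know
    these values up to exponential order.

    For the simple walk this gives [rho = lam / d] ([srw_mixing_rateE]).  For the
    non-backtracking walk, [g_k(d)] is of order [q ^ k], and the growth of
    [g_k(x)] is that of the larger root of [z + q / z = x].  If
    [lam < 2 sqrt q], all relevant roots have modulus [sqrt q], whence
    [rho~ = 1 / sqrt q] ([nbrw_mixing_rate_small]).  If [lam >= 2 sqrt q], the
    root attached to [lam] is real and at least [lam / 2], which gives the lower
    bound of the first part ([nbrw_mixing_rate_large_ge]); the upper bound comes
    from [lam <= d] ([nbrw_mixing_rate_large_le]).

    In the second part the ratio is [d / (lam sqrt q)], so it remains to show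
    that [lam >= (2 - o(1)) sqrt q].  Counting the closed walks of length [2k]
    that are closed in the universal cover gives at least
    [Catalan_k * q ^ k] of them at each vertex, while the spectral theorem bounds
    their number by [lam ^ (2k) + d ^ (2k) / n]
    ([second_eigenvalue_catalan]).  For fixed [k] the last term is eventually
    at most [1], because [d = n ^ o(1)], and [Catalan_k ^ (1 / 2k)] tends to
    [2]. *)

Set Implicit Arguments.
Unset Strict Implicit.
Unset Printing Implicit Defensive.

Import Order.TTheory GRing.Theory Num.Theory.
Import numFieldNormedType.Exports.

Local Open Scope classical_set_scope.
Local Open Scope ring_scope.

(** * Spectral resolution of a real symmetric matrix *)

Local Notation "M ^t*" := (map_mx Num.conj (M ^T)) : ring_scope.

Lemma char_poly_diagonalized (F : fieldType) n (P : 'M[F]_n) (D : 'rV[F]_n) :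
  P \in unitmx ->
  char_poly (invmx P *m diag_mx D *m P) = \prod_(i < n) ('X - (D 0 i)%:P).
Proof.
move=> uP; transitivity (char_poly (diag_mx D)); last first.
  rewrite char_poly_trig ?diag_mx_is_trig //.
  by apply: eq_bigr => i _; rewrite mxE eqxx.
rewrite /char_poly.
suff -> : char_poly_mx (invmx P *m diag_mx D *m P) = map_mx polyC (invmx P)
    *m char_poly_mx (diag_mx D) *m map_mx polyC P.
  by rewrite !det_mulmx mulrAC -det_mulmx -map_mxM mulVmx // map_mx1 det1 mul1r.
rewrite /char_poly_mx !map_mxM mulmxBr mulmxBl; congr (_ - _).
by rewrite scalar_mxC -mulmxA -map_mxM mulVmx // map_mx1 mulmx1.
Qed.

(** The matrices [E i] are the real parts of the rank-one orthogonal projectors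
    given by a complex unitary diagonalization.  Taking real parts keeps every
    relation that is linear in the projector, because [A] and its eigenvalues
    are real; it may destroy idempotence when an eigenvalue is repeated, which
    is why only linear relations, the traces and the signs of the diagonal
    entries are recorded. *)
Lemma symmetric_spectral_resolution (R : realType) n (A : 'M[R]_n) :
  A^T = A ->
  exists (D : 'I_n -> R) (E : 'I_n -> 'M[R]_n),
  [/\ char_poly A = \prod_i ('X - (D i)%:P),
      \sum_i E i = 1%:M,
      forall i, [/\ A *m E i = D i *: E i, E i *m A = D i *: E i & (E i)^T = E i],
      forall i, \tr (E i) = 1 &
      forall i u, 0 <= E i u u].
Proof.
move=> Asym.
pose f : {rmorphism R -> R[i]} := real_complex R.
pose B := map_mx f A.
have Bh : B \is hermsymmx.
  apply: realsym_hermsym.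
    apply/is_hermitianmxP; rewrite expr0 scale1r map_mx_id //.
    by rewrite /B map_trmx Asym.
  by apply/mxOverP => i j; rewrite !mxE; apply/Creal_ImP; rewrite -complexIm.
have Dr := hermitian_spectral_diag_real Bh.
have /hermitian_normalmx /orthomx_spectralP := Bh.
set P := spectralmx B in Dr *; set D := spectral_diag B in Dr * => BE.
have uP : P \in unitmx by exact: spectral_unit.
have PV : invmx P = P^t* by apply: invmx_unitary; exact: spectral_unitarymx.
have DE i : D 0 i = f (complex.Re (D 0 i)).
  by have /mxOverP/(_ 0 i)/RRe_real := Dr.
pose C i : 'M[R[i]]_n := invmx P *m delta_mx i i *m P.
exists (fun i => complex.Re (D 0 i)), (fun i => map_mx (@complex.Re R) (C i)).
have CT i : (C i)^t* = C i.
  rewrite /C PV !trmx_mul !map_mxM trmx_delta map_delta_mx mulmxA.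
  congr (_ *m _ *m _); apply/matrixP => a b; rewrite !mxE.
  exact: conjCK.
have BC i : B *m C i = D 0 i *: C i.
  rewrite {1}BE /C !mulmxA mulmxK // -(mulmxA _ (diag_mx D)).
  suff -> : diag_mx D *m delta_mx i i = D 0 i *: delta_mx i i.
    by rewrite -scalemxAr -scalemxAl.
  apply/matrixP => a b; rewrite mul_diag_mx !mxE.
  by case: eqP => [->//|_]; rewrite !mulr0.
have ReAdd : {morph (@complex.Re R) : x y / x + y} by case=> ? ? [].
have ReZ (a : R) z : complex.Re (f a * z) = a * complex.Re z.
  by case: z => x y /=; rewrite mul0r subr0.
have ReD i : A *m map_mx (@complex.Re R) (C i)
  = complex.Re (D 0 i) *: map_mx (@complex.Re R) (C i).
  apply/matrixP => a b; have /matrixP/(_ a b) := BC i.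
  rewrite !mxE DE => /(congr1 (@complex.Re R)); rewrite ReZ => <-.
  rewrite (big_morph _ ReAdd (erefl _)); apply: eq_bigr => c _.
  by rewrite !mxE ReZ.
have ReT i : (map_mx (@complex.Re R) (C i))^T = map_mx (@complex.Re R) (C i).
  move: (C i) (CT i) => M MT; apply/matrixP => a b.
  rewrite !mxE -[in RHS]MT !mxE; case: (M b a) => x y; reflexivity.
split; [| |move=> i|move=> i|move=> i u].
- apply: (map_poly_inj f); rewrite map_char_poly -/B BE char_poly_diagonalized //.
  rewrite rmorph_prod; apply: eq_bigr => i _.
  by rewrite rmorphB /= map_polyX map_polyC /= -DE.
- have sumC : \sum_i C i = 1%:M.
    rewrite /C -mulmx_suml -mulmx_sumr -[in RHS](mulVmx uP); congr (_ *m _).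
    suff -> : \sum_i delta_mx i i = 1%:M :> 'M[R[i]]_n by rewrite mulmx1.
    apply/matrixP => a b; rewrite summxE !mxE (bigD1 a) //= big1 => [|c ca].
      by rewrite mxE eqxx addr0 eq_sym.
    by rewrite mxE eq_sym (negbTE ca).
  apply/matrixP => a b; have /matrixP/(_ a b)/(congr1 (@complex.Re R)) := sumC.
  rewrite !summxE (big_morph _ ReAdd (erefl _)) !mxE.
  rewrite (_ : complex.Re (_ *+ _) = (a == b)%:R); last by case: (a == b).
  by move=> <-; apply: eq_bigr => i _; rewrite mxE.
- split => //.
  by have := congr1 trmx (ReD i); rewrite trmx_mul linearZ /= Asym ReT.
- transitivity (complex.Re (\tr (C i))).
    rewrite /mxtrace (big_morph _ ReAdd (erefl _)).
    by apply: eq_bigr => a _; rewrite mxE.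
  rewrite /C mxtrace_mulC mulKVmx // /mxtrace (bigD1 i) //= mxE eqxx.
  by rewrite big1 ?addr0 // => j ji; rewrite mxE (negbTE ji).
- rewrite mxE; have : 0 <= C i u u.
    rewrite /C PV mxE.
    rewrite (bigD1 i) //= big1 ?addr0 => [|j ji].
      rewrite !mxE (bigD1 i) //= big1 ?addr0 => [|j ji].
        by rewrite !mxE !eqxx mulr1 mulrC -normCK exprn_ge0.
      by rewrite !mxE (negbTE ji) mulr0.
    rewrite mxE big1 ?mul0r // => k _; rewrite !mxE (negbTE ji) andbF mulr0 //.
  by rewrite lecE /= => /andP[].
Qed.

(** * Mixing rates from geometric bounds *)

Lemma bernoulli_inequality (R : realType) (h : R) k : 0 <= h -> 1 + k%:R * h <= (1 + h) ^+ k.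
Proof.
move=> h0; elim: k => [|k IH]; first by rewrite mul0r addr0.
rewrite exprS; apply: le_trans (ler_wpM2l _ IH); last by lra.
have k0 : 0 <= k%:R :> R by [].
rewrite -natr1; nra.
Qed.

(** This absorbs every constant factor in front of a geometric sequence, so that
    k-th roots never have to be taken to the limit. *)
Lemma geometric_domination (R : realType) (a b C : R) : 0 <= a -> a < b ->
  exists N, forall k, (N <= k)%N -> C * a ^+ k <= b ^+ k.
Proof.
move=> a0 ab; have b0 : 0 < b by lra.
have [a_eq0|an0] := eqVneq a 0.
  by exists 1%N => -[//|k] _; rewrite a_eq0 expr0n mulr0 exprn_ge0 // ltW.
have {a0 an0} a0 : 0 < a by rewrite lt0r an0.
pose h := b / a - 1.
have h0 : 0 < h by rewrite subr_gt0 ltr_pdivlMr // mul1r.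
exists (Num.truncn (C / h)).+1 => k Nk.
rewrite -ler_pdivlMr ?exprn_gt0 // -expr_div_n.
rewrite (_ : b / a = 1 + h); last by rewrite /h addrC subrK.
apply: le_trans (bernoulli_inequality k (ltW h0)).
suff : C <= k%:R * h by lra.
rewrite -ler_pdivrMr //; apply/ltW.
apply: lt_le_trans (truncnS_gt _) _.
by rewrite ler_nat.
Qed.

Section LimSup.
Variables (R : realType) (u : R^nat) (b : R).
Hypothesis u_bounded : forall k, `|u k| <= b.

Let bdu : bounded_fun (u : R^o^nat).
Proof.
exists b; split=> [|M bM x _ /=]; first exact: num_real.
by rewrite (le_trans (u_bounded x)) // ltW.
Qed.

Let has_sup_sdrop N : has_sup (sdrop u N).
Proof.
split; first by exists (u N), N => //=.
by exists b => _ [k _ <-]; rewrite (le_trans (ler_norm _)).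
Qed.

Lemma limn_sup_le t N : (forall k, (N <= k)%N -> u k <= t) -> limn_sup u <= t.
Proof.
move=> ut; rewrite limn_supE //.
apply: (@le_trans _ _ (sups u N)).
  apply: ge_inf; last by exists N.
  by apply: bounded_fun_has_lbound_sups.
apply: sup_le_ub; first by case: (has_sup_sdrop N).
by move=> _ [k /= Nk <-]; exact: ut.
Qed.

Lemma limn_sup_ge t :
  (forall N, exists2 k, (N <= k)%N & t <= u k) -> t <= limn_sup u.
Proof.
move=> tu; rewrite limn_supE //; apply: lb_le_inf; first by exists (sups u 0%N), 0%N.
move=> _ [N _ <-]; have [k Nk tk] := tu N.
by apply: le_trans tk _; apply: sup_upper_bound => //; exists k.
Qed.

End LimSup.

Lemma powR_invn_le (R : realType) (x y : R) k : 0 <= x -> 0 <= y -> (0 < k)%N ->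
  (x `^ k%:R^-1 <= y) = (x <= y ^+ k).
Proof.
move=> x0 y0 k0; rewrite -(ler_pXn2r k0) ?nnegrE ?powR_ge0 //.
by rewrite -(powR_mulrn k (powR_ge0 _ _)) -powRrM mulVf ?pnatr_eq0 -?lt0n // powRr1.
Qed.

Section MixingRate.
Variables (R : realType) (G : sgraph) (P : nat -> G -> G -> R).
Local Notation dev k u v := (`|P k u v - #|G|%:R^-1|).
Local Notation root_dev k := (\big[Num.max/0]_(u : G) \big[Num.max/0]_(v : G)
  (dev k u v `^ k%:R^-1)).

Let root_dev_le k (y : R) : 0 <= y -> (0 < k)%N ->
  (forall u v, dev k u v <= y ^+ k) -> root_dev k <= y.
Proof.
move=> y0 k0 H; apply: bigmax_le => // u _; apply: bigmax_le => // v _.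
by rewrite powR_invn_le.
Qed.

Let root_dev_ge k (y : R) u v : 0 <= y -> (0 < k)%N ->
  y ^+ k <= dev k u v -> y <= root_dev k.
Proof.
move=> y0 k0 H; apply: le_trans (le_bigmax _ _ u); apply: le_trans (le_bigmax _ _ v).
have -> : y = (y ^+ k) `^ k%:R^-1.
  by rewrite -powR_mulrn // -powRrM mulfV ?pnatr_eq0 -?lt0n // powRr1.
by apply: ge0_ler_powR H; rewrite ?nnegrE ?invr_ge0 ?exprn_ge0.
Qed.

Let root_dev_ge0 k : 0 <= root_dev k.
Proof. exact: bigmax_ge_id. Qed.

Let root_dev_bounded C t : 0 <= t -> (forall k u v, dev k u v <= C * t ^+ k) ->
  exists b, forall k, `|root_dev k| <= b.
Proof.
move=> t0 H; exists (Num.max 1 (Num.max 1 C * t)) => k; rewrite ger0_norm //.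
case: k => [|k].
  (* At k = 0 the exponent is 0^-1 = 0, so every root is 1. *)
  apply: bigmax_le => [|u _]; first by rewrite le_max ler01.
  apply: bigmax_le => [|v _]; first by rewrite le_max ler01.
  by rewrite invr0 powRr0 le_max lexx.
rewrite le_max; apply/orP; right.
have C1 : 1 <= Num.max 1 C by rewrite le_max lexx.
have C0 := le_trans ler01 C1.
apply: root_dev_le => [||u v] //; first exact: mulr_ge0.
apply: le_trans (H _ _ _) _; rewrite exprMn ler_wpM2r ?exprn_ge0 //.
apply: (@le_trans _ _ (Num.max 1 C)); first by rewrite le_max lexx orbT.
by rewrite exprS ler_peMr // exprn_ege1.
Qed.

(** The constant [C] disappears: [C * t ^ k] is eventually at most [(t + e) ^ k]
    for each [e > 0]. *)
Lemma mixing_rate_le C t : 0 < t ->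
  (forall k u v, dev k u v <= C * t ^+ k) -> mixing_rate P <= t.
Proof.
move=> t0 H; have [b bP] := root_dev_bounded (ltW t0) H.
apply/ler_addgt0Pr => e e0.
have [|N NP] := @geometric_domination R t (t + e) C (ltW t0).
  by rewrite ltrDl.
apply: (limn_sup_le bP (N := N.+1)) => k Nk.
apply: root_dev_le => [||u v]; first by rewrite addr_ge0 // ltW.
  exact: leq_ltn_trans Nk.
apply: le_trans (H _ _ _) _; apply: NP; exact: ltnW.
Qed.

(** The upper bound with [C] and [T] only serves to make the sequence of roots
    bounded, without which its limsup would carry no information.  The lower
    bound is asked for infinitely many [k] only, because the deviation of a
    non-backtracking walk may nearly vanish at some times. *)
Lemma mixing_rate_ge C T c t : 0 <= T -> 0 < c -> 0 < t ->
  (forall k u v, dev k u v <= C * T ^+ k) ->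
  (forall N, exists2 k, (N <= k)%N & exists u v, c * t ^+ k <= dev k u v) ->
  t <= mixing_rate P.
Proof.
move=> T0 c0 t0 H L; have [b bP] := root_dev_bounded T0 H.
have [//|mt] := leP t.
(* a lies strictly between the mixing rate and t. *)
pose a := (Num.max 0 (mixing_rate P) + t) / 2.
have [m0 mM] : 0 <= Num.max 0 (mixing_rate P) /\
   mixing_rate P <= Num.max 0 (mixing_rate P).
  by rewrite !le_max !lexx orbT.
have mM' : Num.max 0 (mixing_rate P) < t by rewrite gt_max t0 mt.
have a0 : 0 <= a by rewrite /a; lra.
have [|N NP] := @geometric_domination R a t c^-1 a0; first by rewrite /a; lra.
suff : a <= mixing_rate P by rewrite /a; lra.
apply: (limn_sup_ge bP) => M.
have [k Mk [u [v uv]]] := L (maxn M N).+1.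
exists k; first exact: leq_trans (leq_maxl _ N) (ltnW Mk).
apply: (@root_dev_ge k _ u v) => //; first exact: leq_ltn_trans Mk.
apply: le_trans uv; rewrite -ler_pdivrMl //; apply: NP.
exact: leq_trans (leq_maxr M _) (ltnW Mk).
Qed.

End MixingRate.

(** * The non-backtracking recurrence *)

Section Recurrence.
Variables (R : realType) (q x : R) (h : nat -> R).
Hypothesis hrec : forall k, h k.+2 = x * h k.+1 - q * h k.
Hypothesis q0 : 0 < q.

(** The hypothesis says that [x] lies inside the ellipse that is the image of the
    circle of radius [t] under [z |-> z + q / z], so that both characteristic roots have modulus
    less than [t] (or equal to [t], when [q = t ^ 2]).  Rather than solving the
    recurrence, rescale it to [u k = h k / t ^ k], with [w = q / t ^ 2 <= 1] and
    [x / t = s * (1 + w)], [|s| < 1]; the quadratic form [V] below never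
    increases along the rescaled recurrence and controls [u k.+1 ^ 2].  This
    treats real, double and complex characteristic roots at once. *)
Lemma recurrence_bound t : 0 < t -> q <= t ^+ 2 -> `|x| < t + q / t ->
  exists C, forall k, `|h k| <= C * t ^+ k.
Proof.
move=> t0 qt xt; pose w := q / t ^+ 2; pose s := x / (t + q / t).
have tn0 : t != 0 by rewrite gt_eqF.
have qt0 : 0 < q / t by rewrite divr_gt0.
have y0 : 0 < t + q / t by rewrite addr_gt0.
have w0 : 0 < w by rewrite divr_gt0 ?exprn_gt0.
have w1 : w <= 1 by rewrite ler_pdivrMr ?exprn_gt0 // mul1r.
have s1 : s ^+ 2 < 1.
  rewrite -real_normK ?num_real // expr_lt1 // normrM normfV (gtr0_norm y0).
  by rewrite ltr_pdivrMr // mul1r.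
have xE : x / t = s * (1 + w).
  by rewrite /s /w; field; rewrite tn0 /= addrC -expr2 gt_eqF // addr_gt0 ?exprn_gt0.
pose u k := h k / t ^+ k.
have urec k : u k.+2 = s * (1 + w) * u k.+1 - w * u k.
  by rewrite -xE /u /w hrec !exprS; field; rewrite tn0 expf_neq0.
pose V k := u k.+1 ^+ 2 - 2 * w * s * u k * u k.+1 + w ^+ 2 * u k ^+ 2.
have VS k : V k.+1 <= V k.
  rewrite -subr_ge0.
  have -> : V k - V k.+1 = (1 - w ^+ 2) * (1 - s ^+ 2) * u k.+1 ^+ 2.
    by rewrite /V urec; ring.
  have w2 : w ^+ 2 <= 1 by rewrite expr_le1 // ltW.
  by rewrite mulr_ge0 ?sqr_ge0 // mulr_ge0 // subr_ge0 // ltW.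
have V0 k : V k <= V 0%N by elim: k => // k; apply: le_trans.
pose K := V 0%N / (1 - s ^+ 2) + u 0%N ^+ 2.
have s2 : 0 < 1 - s ^+ 2 by rewrite subr_gt0.
have uV k : (1 - s ^+ 2) * u k.+1 ^+ 2 <= V k.
  by rewrite -subr_ge0 (_ : _ - _ = (s * u k.+1 - w * u k) ^+ 2) ?sqr_ge0 // /V; ring.
have uK k : u k ^+ 2 <= K.
  have Kk j : u j.+1 ^+ 2 <= V 0%N / (1 - s ^+ 2).
    by rewrite ler_pdivlMr // mulrC (le_trans (uV j)).
  rewrite /K; case: k => [|k].
    by rewrite lerDr (le_trans _ (Kk 0%N)) ?sqr_ge0.
  by rewrite (le_trans (Kk k)) // lerDl sqr_ge0.
exists (K + 1) => k.
rewrite -ler_pdivrMr ?exprn_gt0 // -[X in _ / X]gtr0_norm ?exprn_gt0 //.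
rewrite -normfV -normrM -/(u k); apply: (@le_trans _ _ (u k ^+ 2 + 1)).
  have := sqr_ge0 (`|u k| - 1); rewrite sqrrB1 real_normK ?num_real //.
  have := normr_ge0 (u k); lra.
by rewrite lerD2r.
Qed.

(** When [x ^ 2 >= 4 q], the ratio [x / 2] propagates:
    [x - q * (2 / x) >= x / 2]. *)
Lemma recurrence_growth : 0 < x -> 4 * q <= x ^+ 2 ->
  0 < h 0%N -> x / 2 * h 0%N <= h 1%N -> forall k, (x / 2) ^+ k * h 0%N <= h k.
Proof.
move=> x0 xq h0 h1 k.
suff [] : (x / 2) ^+ k * h 0%N <= h k /\ x / 2 * h k <= h k.+1 by [].
elim: k => [|k [IH1 IH2]]; first by rewrite mul1r.
have IH : (x / 2) ^+ k.+1 * h 0%N <= h k.+1.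
  by apply: le_trans IH2; rewrite exprS -mulrA ler_wpM2l //; lra.
split=> //; rewrite hrec -subr_ge0.
have hk : 0 < h k by apply: lt_le_trans IH1; rewrite mulr_gt0 // exprn_gt0 //; lra.
have -> : x * h k.+1 - q * h k - x / 2 * h k.+1
  = x / 2 * (h k.+1 - x / 2 * h k) + (x ^+ 2 - 4 * q) / 4 * h k by field.
rewrite addr_ge0 // mulr_ge0 //; lra.
Qed.

(** When the characteristic roots are complex, the quadratic form
    [h k.+1 ^ 2 - x h k h k.+1 + q h k ^ 2] is definite and is multiplied by [q]
    at each step.  Hence one of any two consecutive terms is of order
    [sqrt q ^ k]; a single term may be small. *)
Lemma recurrence_oscillation : x ^+ 2 < 4 * q -> (h 0%N != 0) || (h 1%N != 0) ->
  exists2 c, 0 < c & forall N, exists2 k,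
    (N <= k)%N & c * Num.sqrt q ^+ k <= `|h k|.
Proof.
move=> xq hn0.
pose V k := h k.+1 ^+ 2 - x * h k * h k.+1 + q * h k ^+ 2.
have VE k : V k = q ^+ k * V 0%N.
  elim: k => [|k IH]; first by rewrite mul1r.
  by rewrite exprS -mulrA -IH /V hrec; ring.
have q4 : 0 < 4 * q by rewrite mulr_gt0.
have V0 : 0 < V 0%N.
  rewrite -(pmulr_rgt0 _ q4).
  have -> : 4 * q * V 0%N = (2 * q * h 0%N - x * h 1%N) ^+ 2
     + (4 * q - x ^+ 2) * h 1%N ^+ 2 by rewrite /V; ring.
  have [h10|h1] := eqVneq (h 1%N) 0.
    rewrite h10 mulr0 subr0 expr0n mulr0 addr0 exprn_even_gt0 //=.
    by rewrite h10 eqxx orbF in hn0; rewrite !mulf_neq0 // gt_eqF.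
  by rewrite ltr_wpDl ?sqr_ge0 // mulr_gt0 ?subr_gt0 // exprn_even_gt0.
pose c := Num.sqrt (V 0%N / (4 * q)).
have VV0 : 0 < V 0%N / (4 * q) by rewrite divr_gt0 // mulr_gt0.
have c0 : 0 < c by rewrite sqrtr_gt0.
exists c => // N.
have hE k : (c * Num.sqrt q ^+ k <= `|h k|) = (V 0%N / (4 * q) * q ^+ k <= h k ^+ 2).
  have H0 : 0 <= c * Num.sqrt q ^+ k by rewrite mulr_ge0 ?exprn_ge0 ?sqrtr_ge0 ?ltW.
  rewrite -[LHS](@ler_pXn2r _ 2) ?nnegrE // real_normK ?num_real // exprMn.
  by rewrite -exprM mulnC exprM !sqr_sqrtr // ltW.
have VN : V N <= 2 * (h N.+1 ^+ 2 + q * h N ^+ 2).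
  rewrite -subr_ge0 -(pmulr_rge0 _ q4).
  have -> : 4 * q * (2 * (h N.+1 ^+ 2 + q * h N ^+ 2) - V N)
    = (2 * q * h N + x * h N.+1) ^+ 2 + (4 * q - x ^+ 2) * h N.+1 ^+ 2
    by rewrite /V; ring.
  by rewrite addr_ge0 ?sqr_ge0 // mulr_ge0 ?sqr_ge0 // subr_ge0 ltW.
have [H|H] := leP (V N / 4) (h N.+1 ^+ 2).
  exists N.+1 => //; rewrite hE (le_trans _ H) // (VE N) exprS.
  by rewrite le_eqVlt; apply/orP; left; apply/eqP; field; rewrite gt_eqF.
exists N => //; rewrite hE -(ler_pM2l q0) (@le_trans _ _ (V N / 4)) //; last by lra.
by rewrite (VE N) le_eqVlt; apply/orP; left; apply/eqP; field; rewrite gt_eqF.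
Qed.

End Recurrence.

(** The polynomial of degree [k], at [x], that turns the adjacency matrix of a
    [(q + 1)]-regular graph into the matrix counting non-backtracking walks of
    length [k].  The term [k = 2] is special, since a vertex has [q + 1]
    neighbours to backtrack to after one step, and [q] afterwards. *)
Definition nb_coef (R : realType) (q x : R) (k : nat) : R :=
  if k is j.+1 then
    (iter j (fun p => (p.2, x * p.2 - q * p.1)) (x, x ^+ 2 - (q + 1))).1
  else 1.

Section NbCoef.
Variables (R : realType).
Implicit Types q x : R.

Lemma nb_coef3 q x k :
  nb_coef q x k.+3 = x * nb_coef q x k.+2 - q * nb_coef q x k.+1.
Proof. by []. Qed.

Lemma nb_coefN q x k : `|nb_coef q (- x) k| = `|nb_coef q x k|.
Proof.
case: k => // k; have nbN j : nb_coef q (- x) j.+1 = (-1) ^+ j.+1 * nb_coef q x j.+1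
  /\ nb_coef q (- x) j.+2 = (-1) ^+ j.+2 * nb_coef q x j.+2.
  elim: j => [|j [IH1 IH2]]; first by rewrite /nb_coef /=; split; ring.
  by split=> //; rewrite !nb_coef3 IH2 IH1 !exprS; ring.
by have [-> _] := nbN k; rewrite normrM normrX normrN1 expr1n mul1r.
Qed.

(** These values are the normalizing constants of the walk: the all-ones function is
    an eigenfunction for the degree [q + 1]. *)
Lemma nb_coef_degree q k : nb_coef q (q + 1) k.+1 = (q + 1) * q ^+ k.
Proof.
suff [] : nb_coef q (q + 1) k.+1 = (q + 1) * q ^+ k /\
          nb_coef q (q + 1) k.+2 = (q + 1) * q ^+ k.+1 by [].
elim: k => [|k [IH1 IH2]]; first by rewrite /nb_coef /=; split; ring.
by split=> //; rewrite nb_coef3 IH2 IH1 !exprS; ring.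
Qed.

Lemma nb_coef_bound q x t : 0 < q -> 0 < t -> q <= t ^+ 2 -> `|x| < t + q / t ->
  exists2 C, 0 <= C & forall k, `|nb_coef q x k| <= C * t ^+ k.
Proof.
move=> q0 t0 qt xt.
have [C HC] := recurrence_bound (h := fun k => nb_coef q x k.+1) (nb_coef3 q x)
  q0 t0 qt xt.
have C0 : 0 <= C by have := HC 0%N; rewrite mulr1; apply: le_trans.
have Ct0 : 0 <= C / t by rewrite divr_ge0 // ltW.
exists (1 + C / t) => [|[|k]]; first exact: addr_ge0.
  by rewrite normr1 mulr1 lerDl.
apply: le_trans (HC k) _; rewrite exprS mulrA mulrDl divfK ?gt_eqF // mul1r.
by rewrite ler_wpM2r ?exprn_ge0 ?lerDr // ltW.
Qed.

Lemma nb_coef_growth q x : 1 < q -> 4 * q <= x ^+ 2 ->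
  exists2 c, 0 < c & forall k, c * (`|x| / 2) ^+ k <= `|nb_coef q x k|.
Proof.
move=> q1 xq; have q0 : 0 < q by lra.
have xn0 : x != 0 by apply: contraTneq xq => ->; rewrite expr0n /=; lra.
wlog x0 : x xq xn0 / 0 < x => [wl|].
  have [x0|] := ltP 0 x; first exact: wl.
  rewrite le_eqVlt (negbTE xn0) /= => x0.
  have [|||c c0 H] := wl (- x); rewrite ?sqrrN ?oppr_eq0 ?oppr_gt0 //.
  by exists c => // k; rewrite -nb_coefN -[`|x|]normrN.
have H := @recurrence_growth R q x (fun k => nb_coef q x k.+1) (nb_coef3 q x)
  x0 xq x0.
have {}H : forall k, (x / 2) ^+ k * x <= nb_coef q x k.+1.
  by apply: H; rewrite /nb_coef /= mulrAC -expr2; lra.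
exists 1 => // k; rewrite mul1r (gtr0_norm x0); case: k => [|k].
  by rewrite expr0 normr1.
apply: le_trans (ler_norm _); apply: le_trans (H k).
rewrite exprSr ler_wpM2l ?exprn_ge0 //; lra.
Qed.

Lemma nb_coef_oscillation q x : 0 < q -> x ^+ 2 < 4 * q ->
  exists2 c, 0 < c & forall N, exists2 k,
    (N <= k)%N & c * Num.sqrt q ^+ k <= `|nb_coef q x k|.
Proof.
move=> q0 xq; have sq0 : 0 < Num.sqrt q by rewrite sqrtr_gt0.
have [|c c0 H] := recurrence_oscillation (h := fun k => nb_coef q x k.+1)
  (nb_coef3 q x) q0 xq.
  rewrite /nb_coef /=; have [->/=|//] := eqVneq x 0.
  rewrite expr0n /= sub0r oppr_eq0 gt_eqF //; lra.
exists (c / Num.sqrt q) => [|N]; first exact: divr_gt0.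
have [k Nk Hk] := H N; exists k.+1; first exact: leqW.
by rewrite exprS mulrA divfK ?gt_eqF.
Qed.

End NbCoef.

(** * Counting non-backtracking walks *)

Lemma sum_pred1 (T : finType) (a : T) (F : T -> nat) :
  (\sum_x (a == x) * F x = F a)%N.
Proof.
rewrite (bigD1 a) //= eqxx mul1n big1 ?addn0 // => x xa.
by rewrite eq_sym (negbTE xa).
Qed.

Lemma sum_tuple_rcons (T : finType) k (F : seq T -> nat) :
  (\sum_(w : k.+1.-tuple T) F w = \sum_(w : k.-tuple T) \sum_(y : T) F (rcons w y))%N.
Proof.
rewrite pair_big /=.
rewrite (reindex (fun p : k.-tuple T * T => [tuple of rcons p.1 p.2])) //=.
apply: onW_bij; apply: inj_card_bij; last first.
  by rewrite card_prod !card_tuple expnSr.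
move=> [w x] [w' x'] /(congr1 val) /= /rcons_inj [ww' ->]; congr (_, _).
exact: val_inj.
Qed.

Lemma forall_ordS k (Q : nat -> bool) :
  [forall t : 'I_k.+1, Q t] = [forall t : 'I_k, Q t] && Q k.
Proof.
apply/forallP/andP => [H|[/forallP H1 H2] t].
  by split; [apply/forallP => t; apply: (H (widen_ord (leqnSn k) t))|apply: (H ord_max)].
have [->//|tk] := eqVneq (t : nat) k.
have tk' : (t < k)%N by rewrite ltn_neqAle tk -ltnS ltn_ord.
exact: (H1 (Ordinal tk')).
Qed.

Section WalkCounts.
Variable G : sgraph.
Implicit Types (u v x y z : G) (w : seq G).

Definition nb_walk k u w : bool :=
  [&& nth u w 0 == u,
      [forall t : 'I_k, adj (nth u w t) (nth u w t.+1)] &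
      [forall t : 'I_k.-1, nth u w t != nth u w t.+2]].

Definition nb_count k u v : nat := #|[set w in nb_walks k u | nth u w k == v]|.

(** Walks of length [k.+1] whose last step goes from [x] to [y]: the last edge
    is the state that makes non-backtracking walks Markovian. *)
Definition nb_count_edge k u x y : nat :=
  \sum_(w : k.+2.-tuple G)
    [&& nb_walk k.+1 u w, nth u w k == x & nth u w k.+1 == y].

Lemma nb_walk_rcons k u w y : size w = k.+1 ->
  nb_walk k.+1 u (rcons w y) =
  [&& nb_walk k u w, adj (nth u w k) y & (0 < k)%N ==> (nth u w k.-1 != y)].
Proof.
move=> sw; have nthw i : (i <= k)%N -> nth u (rcons w y) i = nth u w i.
  by move=> ik; rewrite nth_rcons sw ltnS ik.
have nthy : nth u (rcons w y) k.+1 = y by rewrite nth_rcons sw ltnn eqxx.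
rewrite /nb_walk nthw //.
rewrite (forall_ordS k (fun t => adj (nth u (rcons w y) t) (nth u (rcons w y) t.+1))).
rewrite nthy nthw //.
have -> : [forall t : 'I_k, adj (nth u (rcons w y) t) (nth u (rcons w y) t.+1)]
   = [forall t : 'I_k, adj (nth u w t) (nth u w t.+1)].
  by apply: eq_forallb => t; rewrite !nthw // ltnW.
have -> : [forall t : 'I_k.+1.-1, nth u (rcons w y) t != nth u (rcons w y) t.+2]
   = [forall t : 'I_k.-1, nth u w t != nth u w t.+2] &&
     ((0 < k)%N ==> (nth u w k.-1 != y)).
  case: k sw nthw nthy => [|k] sw nthw nthy /=.
    by rewrite andbT; apply: eq_forallb => -[].
  rewrite (forall_ordS k (fun t => nth u (rcons w y) t != nth u (rcons w y) t.+2)).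
  rewrite nthy nthw //; congr (_ && _); apply: eq_forallb => t.
  by have tk := ltn_ord t; rewrite !nthw //; lia.
by rewrite -!andbA; do 2 congr (_ && _); rewrite andbCA.
Qed.

Lemma nb_count_sum k u v :
  nb_count k u v = (\sum_(w : k.+1.-tuple G) (nb_walk k u w && (nth u w k == v)))%N.
Proof.
rewrite /nb_count -sum1_card big_mkcond /=; apply: eq_bigr => w _.
by rewrite !inE -/(nb_walk k u w); case: (_ && _).
Qed.

Lemma nb_count0 u v : nb_count 0 u v = (u == v).
Proof.
rewrite nb_count_sum (sum_tuple_rcons 0 (fun w => nb_walk 0 u w && (nth u w 0 == v))).
rewrite (big_pred1 [tuple]) => [|w]; last by rewrite (tuple0 w) /= eqxx.
rewrite (eq_bigr (fun y => (u == y) * (y == v)))%N => [|y _].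
  by rewrite sum_pred1.
rewrite /nb_walk /= eq_sym; case: (u == y) => //=; rewrite mul1n.
by do !(case: forallP => [_|[]] /=; last by case).
Qed.

Lemma nb_count_edge0 u x y : nb_count_edge 0 u x y = ((u == x) && adj x y).
Proof.
rewrite /nb_count_edge (sum_tuple_rcons 1 (fun w =>
   [&& nb_walk 1 u w, nth u w 0 == x & nth u w 1 == y])).
transitivity (\sum_(w : 1.-tuple G) (adj x y * (nb_walk 0 u w && (nth u w 0 == x))))%N.
  apply: eq_bigr => w _; have sw := size_tuple w.
  rewrite (bigD1 y) //= big1 ?addn0 => [|z zy]; last first.
    by rewrite !nth_rcons sw /= (negbTE zy) !andbF.
  rewrite nb_walk_rcons //= !nth_rcons sw /= eqxx !andbT mulnb.
  by case: eqP => [->|_]; rewrite ?andbF // !andbT andbC.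
by rewrite -big_distrr /= -nb_count_sum nb_count0 mulnb andbC.
Qed.

Lemma nb_count_edgeS k u x y :
  nb_count_edge k.+1 u x y = (adj x y * \sum_(z | z != y) nb_count_edge k u z x)%N.
Proof.
rewrite /nb_count_edge (sum_tuple_rcons k.+2 (fun w =>
   [&& nb_walk k.+2 u w, nth u w k.+1 == x & nth u w k.+2 == y])).
rewrite [in RHS]exchange_big big_distrr /=.
apply: eq_bigr => w _; have sw := size_tuple w.
rewrite (bigD1 y) //= big1 ?addn0 => [|z zy]; last first.
  by rewrite !nth_rcons sw ltnn eqxx (negbTE zy) !andbF.
rewrite nb_walk_rcons //= !nth_rcons sw ltnS leqnn ltnn !eqxx andbT.
set a := nth u w k; set b := nth u w k.+1.
rewrite (eq_bigr (fun z => (a == z) * (nb_walk k.+1 u w && (b == x))))%N; last first.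
  by move=> z _; rewrite andbCA mulnb.
rewrite big_mkcond /=.
rewrite (eq_bigr (fun z => (a == z) * ((z != y) * (nb_walk k.+1 u w && (b == x)))))%N.
  rewrite sum_pred1; have [->|_] := eqVneq b x; rewrite ?andbF ?muln0 //.
  by rewrite !andbT; case: nb_walk; case: adj; case: (a != y).
by move=> z _; case: (z != y); rewrite ?mul1n ?muln0.
Qed.

Lemma nb_countS k u v : nb_count k.+1 u v = (\sum_x nb_count_edge k u x v)%N.
Proof.
rewrite nb_count_sum /nb_count_edge exchange_big /=; apply: eq_bigr => w _.
rewrite (eq_bigr (fun x => (nth u w k == x) *
   (nb_walk k.+1 u w && (nth u w k.+1 == v))))%N ?sum_pred1 //.
by move=> x _; rewrite mulnb andbCA.
Qed.

Lemma nb_count_edge_adj k u x y : ~~ adj x y -> nb_count_edge k u x y = 0%N.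
Proof.
by case: k => [|k] /negbTE xy; rewrite ?nb_count_edge0 ?nb_count_edgeS xy ?andbF.
Qed.

Lemma nb_count1 u v : nb_count 1 u v = adj u v.
Proof.
rewrite nb_countS; under eq_bigr do rewrite nb_count_edge0 -mulnb.
by rewrite sum_pred1.
Qed.

Variable d : nat.
Hypothesis Gd : regular d G.

(** Extending a non-backtracking walk of length [k.+1] by an arbitrary edge either
    keeps it non-backtracking or returns along its last edge.  The backtracking
    extensions that end at [v] are counted by the second sum on the left, which
    the next lemmas evaluate. *)
Lemma nb_countSS k u v :
  (nb_count k.+2 u v + \sum_x nb_count_edge k u v x
   = \sum_x nb_count k.+1 u x * adj x v)%N.
Proof.
rewrite nb_countS -big_split /=; apply: eq_bigr => x _.
rewrite nb_count_edgeS nb_countS adj_sym mulnC.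
have [vx|/nb_count_edge_adj ->] := boolP (adj v x); last by rewrite !muln0.
by rewrite !muln1 [in RHS](bigD1 v) //= addnC.
Qed.

Lemma sum_adj x : (\sum_y adj x y)%N = d.
Proof.
rewrite -(Gd x) -sum1_card [RHS]big_mkcond /=; apply: eq_bigr => y _.
by rewrite inE; case: adj.
Qed.

Lemma nb_count_edge0_backtrack u v :
  (\sum_x nb_count_edge 0 u v x = (u == v) * d)%N.
Proof.
rewrite -(sum_adj v) big_distrr /=; apply: eq_bigr => x _.
by rewrite nb_count_edge0 mulnb.
Qed.

Lemma nb_count_edgeS_backtrack k u v :
  (\sum_x nb_count_edge k.+1 u v x = d.-1 * nb_count k.+1 u v)%N.
Proof.
under eq_bigr do rewrite nb_count_edgeS big_distrr big_mkcond /=.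
rewrite exchange_big nb_countS big_distrr /=; apply: eq_bigr => z _.
have [zv|/nb_count_edge_adj H] := boolP (adj z v); last first.
  by rewrite H muln0 big1 // => x _; rewrite muln0 if_same.
have -> : d.-1 = (\sum_(x | x != z) adj v x)%N.
  by rewrite -(sum_adj v) (bigD1 z) //= adj_sym zv.
rewrite big_distrl [RHS]big_mkcond /=; apply: eq_bigr => x _.
by rewrite eq_sym.
Qed.

End WalkCounts.

(** * The spectrum of a connected regular graph *)

(** Since [d] is the first entry and occurs once, the other entries lie between
    the second one and the last one. *)
Lemma second_largest_abs (R : realDomainType) (s : seq R) (d : R) :
  sorted >=%R s -> count_mem d s = 1%N -> {in s, forall a, `|a| <= d} ->
  (1 < size s)%N ->
  (forall a, a \in s -> a != d -> `|a| <= Num.max s`_1 `|s`_(size s).-1|) /\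
  (exists2 a, a \in s & a != d /\ `|a| = Num.max s`_1 `|s`_(size s).-1|).
Proof.
case: s => [|a [|b r]] //= /andP[ba br] cnt sd _.
have ger_trans : transitive (>=%R : rel R) by move=> x y z; exact: ge_trans.
have rb x : x \in b :: r -> x <= b.
  rewrite in_cons => /predU1P[-> //|]; exact: (allP (order_path_min ger_trans br)).
have lr x : x \in b :: r -> (b :: r)`_(size r) <= x.
  move=> xr; rewrite -[leRHS](nth_index 0 xr).
  apply: (sorted_leq_nth ger_trans (@lexx _ R) 0 (s := b :: r) br);
    rewrite ?inE ?index_mem //.
  by rewrite -ltnS; move: xr; rewrite -index_mem.
have ad : a = d.
  have da : d \in a :: b :: r by rewrite -has_pred1 has_count /= cnt.
  apply: le_anti; rewrite (le_trans (ler_norm a)) ?sd ?mem_head //=.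
  by move: da; rewrite in_cons => /predU1P[<- //|/rb /le_trans]; apply.
have dr : d \notin b :: r.
  by rewrite -has_pred1 has_count; move: cnt => /=; rewrite ad eqxx; lia.
set l := (b :: r)`_(size r) in lr *.
have lb : l \in b :: r by rewrite mem_nth.
split=> [x|].
  rewrite in_cons ad => /predU1P[->|xr _]; first by rewrite eqxx.
  rewrite le_max; have := rb _ xr; have := lr _ xr.
  have [x0|x0] := leP 0 x => H1 H2.
    by rewrite (ger0_norm x0) H2.
  by rewrite (ltr0_norm x0) (ltr0_norm (le_lt_trans H1 x0)) lerN2 H1 orbT.
have inr x : x \in b :: r -> x \in [:: a, b & r] /\ x != d.
  by move=> xr; rewrite in_cons xr orbT; split=> //; apply: contraNneq dr => <-.
have [bl|bl] := leP b `|l|.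
  by exists l; have [] := inr l lb.
exists b; first by have [] := inr b (mem_head _ _).
split; first by have [] := inr b (mem_head _ _).
by rewrite ger0_norm // (le_trans _ (ltW bl)).
Qed.

Section GraphSpectrum.
Variables (R : realType) (G : sgraph) (d : nat).
Hypothesis d1 : (1 < d)%N.
Hypothesis Gd : regular d G.
Hypothesis Gc : connected G.
Local Notation n := #|G|.
Local Notation a u v := ((adj u v)%:R : R).

Lemma sum_adjr (v : G) : \sum_w a w v = d%:R.
Proof.
rewrite -natr_sum -(Gd v) -sum1_card [in RHS]big_mkcond /=; congr _%:R.
by apply: eq_bigr => y _; rewrite inE adj_sym; case: adj.
Qed.

Lemma card_gt1 : (1 < n)%N.
Proof.
have [/card_gt0P[x _] _] := Gc.
by apply: leq_trans d1 _; rewrite -(Gd x) max_card.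
Qed.

(** Compare both sides of the eigenvalue equation where [|e|] is maximal. *)
Lemma eigenfunction_le (e : G -> R) (D : R) :
  (forall v, \sum_w e w * a w v = D * e v) ->
  (exists v, e v != 0) -> `|D| <= d%:R.
Proof.
move=> eD [v0 ev0].
pose v := [arg max_(v > v0) `|e v|]%O.
have vmax w : `|e w| <= `|e v|.
  by rewrite /v; case: arg_maxP => // x _; apply.
have ev : 0 < `|e v| by apply: lt_le_trans (vmax v0); rewrite normr_gt0.
rewrite -(ler_pM2r ev) -normrM -eD -(sum_adjr v) big_distrl /=.
apply: le_trans (ler_norm_sum _ _ _) _; apply: ler_sum => w _.
by rewrite normrM normr_nat mulrC ler_wpM2l.
Qed.

(** Maximum principle: the set where [e] attains its maximum is closed under
    adjacency. *)
Lemma eigenfunction_const (e : G -> R) :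
  (forall v, \sum_w e w * a w v = d%:R * e v) -> forall u v, e u = e v.
Proof.
move=> ed u0 v0; pose v := [arg max_(v > v0) e v]%O.
have vmax w : e w <= e v by rewrite /v; case: arg_maxP => // x _; apply.
suff H : forall w, e w = e v by rewrite !H.
have step x y : e x = e v -> adj x y -> e y = e v.
  move=> xv xy; have : \sum_w (e v - e w) * a w x = 0.
    under eq_bigr do rewrite mulrBl.
    by rewrite sumrB -mulr_sumr sum_adjr ed xv mulrC subrr.
  move/eqP; rewrite psumr_eq0 => [|w _]; last by rewrite mulr_ge0 // subr_ge0.
  move/allP/(_ y (mem_index_enum y)).
  by rewrite adj_sym xy mulr1 subr_eq0 => /eqP.
have walk (p : seq G) : forall x, e x = e v -> path (@adj G) x p -> e (last x p) = e v.
  by elim: p => [|y p IH] x xv //= /andP[xy yp]; apply: IH (step _ _ xv xy) yp.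
by move=> w; have /connectP[p vp ->] := Gc.2 v w; exact: walk.
Qed.

(** The eigenvalue [d] is simple and its projector is constant.  Indeed, for an
    eigenvalue [D i = d] the rows and columns of [E i] are constant by the
    maximum principle, so the trace forces every entry to be [1 / n]; for
    [D i != d] the rows of [E i] sum to zero.  Summing [\sum_i E i = 1] along a
    row then gives [1] on the right and the multiplicity of [d] on the left.
    Simplicity is what makes the second entry of the sorted spectrum, together
    with the last one, bound all eigenvalues other than [D i0]. *)
Lemma graph_spectral_resolution :
  exists (D : 'I_n -> R) (E : 'I_n -> G -> G -> R) (i0 : 'I_n),
  [/\ forall u v, \sum_i E i u v = (u == v)%:R,
      forall i u v, \sum_w E i u w * a w v = D i * E i u v,
      forall i u, 0 <= E i u u,
      forall i, exists u, E i u u != 0 &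
  [/\ D i0 = d%:R,
      forall u v, E i0 u v = n%:R^-1,
      forall i, i != i0 -> forall u, \sum_v E i u v = 0,
      forall i, i != i0 -> `|D i| <= second_eigenvalue R G &
      exists2 i, i != i0 & `|D i| = second_eigenvalue R G]].
Proof.
have n1 := card_gt1.
have nn0 : n%:R != 0 :> R by rewrite pnatr_eq0 -lt0n ltnW.
have As : (adjacency_mx R G)^T = adjacency_mx R G.
  by apply/matrixP => i j; rewrite !mxE adj_sym.
have [D [M [chD sumM MD trM M0]]] := symmetric_spectral_resolution As.
pose E i u v := M i (enum_rank u) (enum_rank v).
have sum_rank (F : 'I_n -> R) : \sum_w F (enum_rank w) = \sum_j F j.
  by rewrite [RHS](reindex (@enum_rank G)) //=; apply: onW_bij; exact: enum_rank_bij.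
have sumE u v : \sum_i E i u v = (u == v)%:R.
  move/matrixP/(_ (enum_rank u) (enum_rank v)): sumM; rewrite summxE mxE => ->.
  by rewrite (inj_eq enum_rank_inj).
have ED i u v : \sum_w E i u w * a w v = D i * E i u v.
  have [_ /matrixP/(_ (enum_rank u) (enum_rank v)) + _] := MD i.
  rewrite !mxE => <-; rewrite -sum_rank; apply: eq_bigr => w _.
  by rewrite mxE !enum_rankK.
have Esym i u v : E i u v = E i v u.
  by rewrite /E; have [_ _ MT] := MD i; rewrite -[in LHS]MT mxE.
have trE i : \sum_u E i u u = 1.
  by rewrite (sum_rank (fun j => M i j j)) -[RHS](trM i).
have Enz i : exists u, E i u u != 0.
  apply/existsP; apply: contraTT isT; rewrite negb_exists => /forallP H.
  have := trE i; rewrite big1 => [|u _]; first by move/esym/eqP; rewrite oner_eq0.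
  by apply/eqP; rewrite -[_ == _]negbK.
have Dd i : `|D i| <= d%:R.
  have [u Eu] := Enz i.
  by apply: (@eigenfunction_le (E i u)) => [v|]; [exact: ED|exists u].
have Econst i : D i = d%:R -> forall u v, E i u v = n%:R^-1.
  move=> Di u v; have c x y z t : E i x y = E i z t.
    have H x' y' z' : E i x' y' = E i x' z'.
      by apply: eigenfunction_const => v'; rewrite -Di ED.
    by rewrite (H x y z) Esym (H z x t).
  apply: (mulIf nn0); rewrite mulVf // -[RHS](trE i).
  under eq_bigr do rewrite (c _ _ u v).
  by rewrite sumr_const mulr_natr.
have Eorth i : D i != d%:R -> forall u, \sum_v E i u v = 0.
  move=> Di u; have : \sum_v \sum_w E i u w * a w v = D i * \sum_v E i u v.
    by rewrite mulr_sumr; apply: eq_bigr => v _; rewrite ED.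
  rewrite exchange_big /=.
  under eq_bigr => w _.
    rewrite -mulr_sumr (eq_bigr (fun v => a v w)); last by move=> v _; rewrite adj_sym.
    rewrite sum_adjr; over.
  rewrite -mulr_suml mulrC => /eqP; rewrite -subr_eq0 -mulrBl mulf_eq0 subr_eq0.
  by rewrite eq_sym (negbTE Di) => /eqP.
have [x0 _] : exists x, x \in G by have [/card_gt0P] := Gc.
have : #|[pred i | D i == d%:R]| == 1%N.
  rewrite -(eqr_nat R); apply/eqP.
  transitivity (\sum_i \sum_v E i x0 v).
    rewrite (bigID (fun i => D i == d%:R)) /= [X in _ + X]big1 ?addr0; last first.
      by move=> i Di; apply: Eorth.
    rewrite (eq_bigr (fun=> 1)) ?sumr_const; last first.
      move=> i /eqP/Econst Ei; rewrite (eq_bigr (fun=> n%:R^-1)) // sumr_const.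
      by rewrite -[LHS]mulr_natr mulVf.
    by congr (_ *+ _); apply: eq_card => i.
  rewrite exchange_big (eq_bigr _ (fun v _ => sumE x0 v)) -natr_sum.
  rewrite (bigD1 x0) //= eqxx big1 // => v; rewrite eq_sym => /negbTE -> //.
move/eqP/mem_card1 => [i0 Hi0].
have Di0 i : (D i == d%:R) = (i == i0) by have := Hi0 i; rewrite !inE.
have [sorted_s chs] := spectrumP R G.
set s := spectrum R G in sorted_s chs.
have perm_s : perm_eq s [seq D i | i <- enum 'I_n].
  apply: prod_XsubC_eq; rewrite -chs chD big_map big_enum //.
have mem_s x : (x \in s) = [exists i, D i == x].
  rewrite (perm_mem perm_s); apply/mapP/existsP => [[i _ ->]|[i /eqP <-]].
    by exists i.
  by exists i => //; rewrite mem_enum.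
have size_s : size s = n by rewrite (perm_size perm_s) size_map size_enum_ord.
have cnt : count_mem (d%:R : R) s = 1%N.
  rewrite (permP perm_s) count_map -sum1_count big_enum_cond /=.
  by rewrite (eq_bigl (pred1 i0)) ?big_pred1_eq.
have [] := second_largest_abs sorted_s cnt.
- by move=> x; rewrite mem_s => /existsP[i /eqP <-].
- by rewrite size_s.
rewrite size_s -/(second_eigenvalue R G) => L1 [x + [xd xl]].
rewrite mem_s => /existsP[i1 /eqP Di1].
exists D, E, i0; split=> //; first by move=> i u; exact: M0.
split.
- by apply/eqP; rewrite Di0.
- by apply: Econst; apply/eqP; rewrite Di0.
- by move=> i ii0; apply: Eorth; rewrite Di0.
- by move=> i ii0; apply: L1; rewrite ?Di0 // mem_s; apply/existsP; exists i.
- by exists i1; rewrite ?Di1 // -Di0 Di1.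
Qed.

End GraphSpectrum.

(** * Mixing rates in terms of the second eigenvalue *)

Section KernelExpansion.
Variables (R : realType) (G : sgraph) (I : finType) (E : I -> G -> G -> R) (i0 : I).
Local Notation n := #|G|.
Hypothesis E_sum : forall u v, \sum_i E i u v = (u == v)%:R.
Hypothesis E_nz : forall i, exists u, E i u u != 0.
Hypothesis E_top : forall u v, E i0 u v = n%:R^-1.
Hypothesis E_orth : forall i, i != i0 -> forall u, \sum_v E i u v = 0.

Lemma kernel_expansion (M : G -> G -> R) (m : I -> R) :
  (forall i u v, \sum_w E i u w * M w v = m i * E i u v) ->
  forall u v, M u v = \sum_i m i * E i u v.
Proof.
move=> EM u v; under eq_bigr do rewrite -EM.
rewrite exchange_big (bigD1 u) //= -mulr_suml E_sum eqxx mul1r big1 ?addr0 //.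
by move=> w wu; rewrite -mulr_suml E_sum eq_sym (negbTE wu) mul0r.
Qed.

(** Apply [E i] to [M - 1/n], which multiplies it by [m i], and compare the two
    sides at a largest entry of a row of [E i]. *)
Lemma kernel_deviation_ge (M : G -> G -> R) (m : I -> R) i : i != i0 ->
  (forall u v, \sum_w E i u w * M w v = m i * E i u v) ->
  exists u v, `|m i| / n%:R <= `|M u v - n%:R^-1|.
Proof.
move=> ii0 EM; have [u0 Eu0] := E_nz i.
have n0 : 0 < n%:R :> R by rewrite ltr0n; apply/card_gt0P; exists u0.
pose v := [arg max_(v > u0) `|E i u0 v|]%O.
have vmax w : `|E i u0 w| <= `|E i u0 v|.
  by rewrite /v; case: arg_maxP => // x _; apply.
have Ev : 0 < `|E i u0 v| by apply: lt_le_trans (vmax u0); rewrite normr_gt0.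
pose w := [arg max_(w > u0) `|M w v - n%:R^-1|]%O.
have wmax x : `|M x v - n%:R^-1| <= `|M w v - n%:R^-1|.
  by rewrite /w; case: arg_maxP => // y _; apply.
exists w, v; rewrite ler_pdivrMr // -(ler_pM2r Ev) -normrM -EM.
have -> : \sum_w E i u0 w * M w v = \sum_w E i u0 w * (M w v - n%:R^-1).
  under [RHS]eq_bigr do rewrite mulrBr.
  by rewrite sumrB -mulr_suml E_orth // mul0r subr0.
apply: le_trans (ler_norm_sum _ _ _) _.
apply: (@le_trans _ _ (\sum_(x : G) `|E i u0 v| * `|M w v - n%:R^-1|)).
  by apply: ler_sum => x _; rewrite normrM ler_pM.
by rewrite sumr_const -[leLHS]mulr_natr [`|E _ _ _| * _]mulrC mulrAC.
Qed.

(** In the expansion of [M k] over the [E i], the term [i0] is exactly the uniform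
    distribution. *)
Lemma kernel_deviation_le (M : nat -> G -> G -> R) (m : nat -> I -> R) t : 0 <= t ->
  (forall k i u v, \sum_w E i u w * M k w v = m k i * E i u v) ->
  (forall k, m k i0 = 1) ->
  (forall i, i != i0 -> exists2 C, 0 <= C & forall k, `|m k i| <= C * t ^+ k) ->
  exists C, forall k u v, `|M k u v - n%:R^-1| <= C * t ^+ k.
Proof.
move=> t0 EM m1 mC.
have /choice[C HC] : forall i, exists C, i != i0 ->
    0 <= C /\ forall k, `|m k i| <= C * t ^+ k.
  move=> i; have [->|ii0] := eqVneq i i0; first by exists 0.
  by have [C C0 HC] := mC i ii0; exists C.
exists (\sum_(i | i != i0) C i * \sum_u \sum_v `|E i u v|) => k u v.
rewrite (kernel_expansion (EM k)) (bigD1 i0) //= m1 mul1r E_top addrAC subrr add0r.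
apply: le_trans (ler_norm_sum _ _ _) _.
rewrite mulr_suml; apply: ler_sum => i ii0; have [C0 Ck] := HC i ii0.
rewrite normrM mulrAC ler_pM //.
rewrite (bigD1 u) //= (bigD1 v) //= -addrA lerDl addr_ge0 ?sumr_ge0 // => x _.
by apply: sumr_ge0.
Qed.

End KernelExpansion.

Section Rates.
Variables (R : realType) (G : sgraph) (d : nat).
Hypothesis d3 : (3 <= d)%N.
Hypothesis Gd : regular d G.
Hypothesis Gc : connected G.
Local Notation n := #|G|.
Local Notation a u v := ((adj u v)%:R : R).
Local Notation q := (d%:R - 1 : R).
Local Notation lam := (second_eigenvalue R G).
Local Notation N k u v := ((nb_count k u v)%:R : R).

Let q2 : 2 <= q.
Proof. have : 3%:R <= d%:R :> R by rewrite ler_nat. lra. Qed.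

Let q0 : 0 < q. Proof. exact: lt_le_trans q2. Qed.

Let d0 : 0 < d%:R :> R. Proof. by rewrite ltr0n; lia. Qed.

Let res := graph_spectral_resolution R (ltnW d3) Gd Gc.

Lemma second_eigenvalue_le : lam <= d%:R.
Proof.
have [D [E [i0 [_ ED _ Enz [_ _ _ _ [i _ <-]]]]]] := res.
have [u Eu] := Enz i; apply: (@eigenfunction_le _ _ d Gd (E i u) (D i)).
  by move=> v; exact: ED.
by exists u.
Qed.

Lemma srw_prob_eigen (e : G -> R) x : (forall v, \sum_w e w * a w v = x * e v) ->
  forall k v, \sum_w e w * srw_prob R k w v = (x / d%:R) ^+ k * e v.
Proof.
move=> ex; elim=> [|k IH] v /=.
  rewrite mul1r (bigD1 v) //= eqxx mulr1 big1 ?addr0 // => w /negbTE ->.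
  by rewrite mulr0.
under eq_bigr do rewrite mulr_sumr.
rewrite exchange_big /=.
under eq_bigr => w _.
  rewrite (Gd w); under eq_bigr do rewrite mulrA.
  rewrite -mulr_suml IH mulrA -[_ * e w * _]mulrA; over.
rewrite -mulr_suml -mulr_sumr ex exprS; ring.
Qed.

Lemma srw_mixing_rateE : 0 < lam -> srw_mixing_rate R G = lam / d%:R.
Proof.
move=> lam0; have [D [E [i0 [Es ED _ Enz [D0 Etop Eorth Dle [i1 i1i0 Di1]]]]]] := res.
have EM k i u v := srw_prob_eigen (ED i u) k v.
have r0 : 0 < lam / d%:R by rewrite divr_gt0.
have [|i ii0|C HC] := kernel_deviation_le Es Etop (ltW r0)
  (m := fun k i => (D i / d%:R) ^+ k) EM.
- by move=> k; rewrite D0 mulfV ?expr1n // gt_eqF.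
- exists 1 => // k; rewrite mul1r normrX lerXn2r ?nnegrE ?(ltW r0) //.
  by rewrite normrM normfV normr_nat ler_wpM2r ?Dle // invr_ge0 ltW.
apply/le_anti; rewrite (mixing_rate_le r0 HC) /=.
have n0 : 0 < n%:R :> R by rewrite ltr0n; case: Gc.
have ni0 : 0 < n%:R^-1 :> R by rewrite invr_gt0.
apply: (mixing_rate_ge (ltW r0) ni0 r0 HC) => k; exists k => //.
have [u [v uv]] := kernel_deviation_ge Enz Eorth
  (m := fun i => (D i / d%:R) ^+ k) i1i0 (EM k i1).
exists u, v; apply: le_trans uv; rewrite mulrC normrX normrM Di1 normfV normr_nat //.
Qed.

Lemma nb_countSSr k (u v : G) : N k.+2 u v = \sum_z N k.+1 u z * a z v
    - (\sum_z nb_count_edge k u v z)%:R.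
Proof.
apply/eqP; rewrite eq_sym subr_eq -natrD nb_countSS natr_sum.
by apply/eqP; apply: eq_bigr => z _; rewrite natrM.
Qed.

Lemma nb_count_eigen (e : G -> R) x : (forall v, \sum_w e w * a w v = x * e v) ->
  forall k v, \sum_w e w * N k w v = nb_coef q x k * e v.
Proof.
move=> ex; have e1 v : \sum_w e w * (w == v)%:R = e v.
  rewrite (bigD1 v) //= eqxx mulr1 big1 ?addr0 // => w /negbTE ->.
  by rewrite mulr0.
have eN k v : (forall v, \sum_w e w * N k w v = nb_coef q x k * e v) ->
  \sum_w e w * \sum_z N k w z * a z v = x * nb_coef q x k * e v.
  move=> IH; under eq_bigr do rewrite mulr_sumr.
  rewrite exchange_big /=; under eq_bigr => z _.
    under eq_bigr do rewrite mulrA.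
    rewrite -mulr_suml IH -mulrA; over.
  by rewrite -mulr_sumr ex mulrCA mulrA.
have N1 v : \sum_w e w * N 1 w v = x * e v.
  by under eq_bigr do rewrite nb_count1; rewrite ex.
suff H k : (forall v, \sum_w e w * N k.+1 w v = nb_coef q x k.+1 * e v) /\
  (forall v, \sum_w e w * N k.+2 w v = nb_coef q x k.+2 * e v).
  case=> [|k] v; last by have [] := H k.
  by under eq_bigr do rewrite nb_count0; rewrite e1 mul1r.
elim: k => [|k [IH1 IH2]]; split => // v.
  under eq_bigr => w _.
    rewrite nb_countSSr (nb_count_edge0_backtrack Gd) natrM mulrBr mulrA; over.
  rewrite sumrB -mulr_suml e1 eN // /nb_coef /=; ring.
under eq_bigr => w _.
  rewrite nb_countSSr (nb_count_edgeS_backtrack Gd) natrM mulrBr (mulrCA (e w)); over.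
rewrite sumrB -mulr_sumr IH1 eN // nb_coef3.
rewrite -subn1 natrB; [ring|lia].
Qed.

Lemma nb_walks_card k (u : G) : #|nb_walks k u|%:R = nb_coef q d%:R k :> R.
Proof.
have -> : #|nb_walks k u| = (\sum_v nb_count k u v)%N.
  under eq_bigr do rewrite nb_count_sum.
  rewrite exchange_big -sum1_card big_mkcond /=; apply: eq_bigr => w _.
  rewrite (eq_bigr (fun v => (nth u w k == v) * nb_walk k u w))%N ?sum_pred1.
    by rewrite inE -/(nb_walk k u w); case: nb_walk.
  by move=> v _; rewrite mulnb andbC.
have sum_adjl (z : G) : \sum_v a z v = d%:R.
  by rewrite -(sum_adjr R Gd z); apply: eq_bigr => v _; rewrite adj_sym.
have step j : \sum_v \sum_z N j u z * a z v = d%:R * (\sum_v nb_count j u v)%:R.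
  rewrite exchange_big /= natr_sum mulr_sumr; apply: eq_bigr => z _.
  by rewrite -mulr_sumr sum_adjl mulrC.
suff H j : (\sum_v nb_count j.+1 u v)%:R = nb_coef q d%:R j.+1 /\
  (\sum_v nb_count j.+2 u v)%:R = nb_coef q d%:R j.+2.
  case: k => [|k]; last by have [] := H k.
  under eq_bigr do rewrite nb_count0 -[nat_of_bool _]muln1.
  by rewrite sum_pred1.
have S1 : (\sum_v nb_count 1 u v)%:R = d%:R :> R.
  by under eq_bigr do rewrite nb_count1; rewrite natr_sum sum_adjl.
elim: j => [|j [IH1 IH2]]; split => //.
  rewrite natr_sum (eq_bigr _ (fun v _ => nb_countSSr 0 u v)) sumrB step S1.
  under [X in _ - X]eq_bigr do rewrite (nb_count_edge0_backtrack Gd).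
  rewrite -natr_sum sum_pred1 /nb_coef /=; ring.
rewrite natr_sum (eq_bigr _ (fun v _ => nb_countSSr j.+1 u v)) sumrB step IH2 nb_coef3.
under [X in _ - X]eq_bigr do rewrite (nb_count_edgeS_backtrack Gd) natrM.
rewrite -mulr_sumr -natr_sum IH1 -subn1 natrB //; lia.
Qed.

Lemma nb_coef_degree_bounds k :
  q ^+ k <= nb_coef q d%:R k <= d%:R / q * q ^+ k.
Proof.
have degE j : nb_coef q d%:R j.+1 = d%:R * q ^+ j.
  by have := nb_coef_degree q j; rewrite subrK.
have qn0 : q != 0 by rewrite gt_eqF.
case: k => [|k]; first by rewrite /= lexx mulr1 ler_pdivlMr // mul1r gerBl ler01.
rewrite degE exprS mulrA divfK // lexx andbT.
by rewrite ler_wpM2r ?exprn_ge0 ?(ltW q0) // gerBl ler01.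
Qed.

Let mnb (x : R) k := nb_coef q x k / nb_coef q d%:R k.

Let nbd0 k : 0 < nb_coef q d%:R k.
Proof.
have /andP[H _] := nb_coef_degree_bounds k.
by apply: lt_le_trans H; rewrite exprn_gt0.
Qed.

Let nbrw_prob_eigen (e : G -> R) x : (forall v, \sum_w e w * a w v = x * e v) ->
  forall k v, \sum_w e w * nbrw_prob R k w v = mnb x k * e v.
Proof.
move=> ex k v; under eq_bigr do rewrite /nbrw_prob nb_walks_card mulrA.
by rewrite -mulr_suml (nb_count_eigen ex) /mnb mulrAC.
Qed.

Let nbrw_deviation_le t : 0 < t -> q <= t ^+ 2 -> lam < t + q / t ->
  exists C, forall k u v,
    `|@nbrw_prob R G k u v - n%:R^-1| <= C * (t / q) ^+ k.
Proof.
move=> t0 qt lt; have [D [E [i0 [Es ED _ Enz [D0 Etop Eorth Dle _]]]]] := res.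
have EM k i u v := nbrw_prob_eigen (ED i u) k v.
apply: (kernel_deviation_le Es Etop _ (m := fun k i => mnb (D i) k) EM).
- by rewrite divr_ge0 // ltW.
- by move=> k; rewrite D0 /mnb mulfV // gt_eqF.
move=> i ii0; have [C C0 HC] := nb_coef_bound q0 t0 qt (le_lt_trans (Dle i ii0) lt).
exists C => // k; have /andP[H _] := nb_coef_degree_bounds k.
rewrite /mnb normrM normfV (gtr0_norm (nbd0 k)) expr_div_n mulrA.
by rewrite ler_pM ?invr_ge0 ?(ltW (nbd0 k)) // lef_pV2 ?posrE ?exprn_gt0.
Qed.

(** The normalization [nb_coef q d k] is of order [q ^ k], which turns the rate
    [t] of the walk counts into the rate [t / q] of the probabilities. *)
Lemma nbrw_mixing_rate_le t : 0 < t -> q <= t ^+ 2 -> lam < t + q / t ->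
  nbrw_mixing_rate R G <= t / q.
Proof.
move=> t0 qt lt; have [C HC] := nbrw_deviation_le t0 qt lt.
exact: (@mixing_rate_le R G (@nbrw_prob R G) C _ (divr_gt0 t0 q0) HC).
Qed.

Lemma nbrw_mixing_rate_ge t c : 0 < t -> 0 < c ->
  (forall x, `|x| = lam -> forall M, exists2 k, (M <= k)%N &
     c * t ^+ k <= `|nb_coef q x k|) ->
  t / q <= nbrw_mixing_rate R G.
Proof.
move=> t0 c0 H.
have [D [E [i0 [Es ED _ Enz [D0 Etop Eorth Dle [i1 i1i0 Di1]]]]]] := res.
have EM k i u v := nbrw_prob_eigen (ED i u) k v.
have n0 : 0 < n%:R :> R by rewrite ltr0n; case: Gc.
(* Radius d is admissible whatever the second eigenvalue is. *)
have [||| C HC] := @nbrw_deviation_le d%:R.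
- by [].
- by have := q2; rewrite expr2; nra.
- by apply: le_lt_trans second_eigenvalue_le _; rewrite ltrDl divr_gt0.
have c'0 : 0 < c * q / d%:R / n%:R by rewrite !(divr_gt0, mulr_gt0).
apply: (@mixing_rate_ge R G (@nbrw_prob R G) C _ _ _ _ c'0 _ HC);
  rewrite ?divr_gt0 ?divr_ge0 ?(ltW q0) //.
move=> M; have [k Mk Hk] := H _ Di1 M; exists k => //.
have [u [v uv]] := kernel_deviation_ge Enz Eorth
  (m := fun i => mnb (D i) k) i1i0 (EM k i1).
exists u, v; apply: le_trans uv.
rewrite [leLHS]mulrAC ler_pM2r ?invr_gt0 // /mnb normrM normfV (gtr0_norm (nbd0 k)).
rewrite ler_pdivlMr //; apply: le_trans Hk.
have /andP[_ Hd] := nb_coef_degree_bounds k.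
apply: (@le_trans _ _ (c * q / d%:R * (t / q) ^+ k * (d%:R / q * q ^+ k))).
  by rewrite ler_wpM2l // !mulr_ge0 ?exprn_ge0 ?divr_ge0 ?invr_ge0 ?ltW.
rewrite le_eqVlt; apply/orP; left; apply/eqP; rewrite expr_div_n; field.
by rewrite !gt_eqF ?exprn_gt0.
Qed.

Lemma nbrw_mixing_rate_large_ge : 4 * q <= lam ^+ 2 -> 0 < lam ->
  lam / 2 / q <= nbrw_mixing_rate R G.
Proof.
move=> lq lam0; have q1 : 1 < q by apply: lt_le_trans q2; rewrite ltr1n.
have lq' x : `|x| = lam -> 4 * q <= x ^+ 2.
  by move=> xl; rewrite -real_normK ?num_real // xl.
have [c1 c10 H1] := nb_coef_growth q1 (lq' lam (gtr0_norm lam0)).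
apply: (@nbrw_mixing_rate_ge _ c1) => [||x xl M]; rewrite ?divr_gt0 //.
exists M => //; move: xl => /eqP; rewrite eqr_norml => /andP[/orP[]/eqP-> _].
  by have := H1 M; rewrite (gtr0_norm lam0).
by rewrite nb_coefN; have := H1 M; rewrite (gtr0_norm lam0).
Qed.

(** The true rate is [b' / q], where [b'] is the larger root of
    [b' + q / b' = lam].  The bound [lam / d] amounts to [b' <= b] with
    [b = lam * q / d], that is to [lam <= b + q / b = lam * q / d + d / lam],
    which follows from [lam <= d] since [q = d - 1].  The radius [t] is taken
    slightly above [b] because equality holds when [lam = d]. *)
Lemma nbrw_mixing_rate_large_le : 4 * q <= lam ^+ 2 -> 0 < lam ->
  nbrw_mixing_rate R G <= lam / d%:R.
Proof.
move=> lq lam0; have ld := second_eigenvalue_le.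
apply/ler_addgt0Pr => e e0.
pose b := lam * q / d%:R; pose t := b + e * q.
have b0 : 0 < b by rewrite divr_gt0 ?mulr_gt0.
have eq0 : 0 < e * q by rewrite mulr_gt0.
have bt : b < t by rewrite ltrDl.
have t0 : 0 < t := lt_trans b0 bt.
have -> : lam / d%:R + e = t / q.
  by rewrite /t /b; field; rewrite !gt_eqF.
have bE : b * d%:R = lam * q by rewrite divfK ?gt_eqF.
have qb : q <= b ^+ 2.
  rewrite -(ler_pM2r (exprn_gt0 2 d0)) -exprMn bE exprMn.
  apply: (@le_trans _ _ (4 * q * q ^+ 2)); last by rewrite ler_wpM2r ?sqr_ge0.
  have -> : 4 * q * q ^+ 2 = q * (2 * q) ^+ 2 by ring.
  rewrite ler_wpM2l ?(ltW q0) // lerXn2r ?nnegrE ?mulr_ge0 ?(ltW q0) ?(ltW d0) //.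
  by have := q2; lra.
apply: nbrw_mixing_rate_le => //.
  by apply: le_trans qb _; rewrite lerXn2r ?nnegrE ?ltW.
rewrite -(ltr_pM2r t0) mulrDl divfK ?gt_eqF // -expr2 -subr_gt0.
have lb : lam <= 2 * b.
  rewrite -(ler_pM2r d0) -mulrA bE mulrCA ler_wpM2l ?(ltW lam0) //; have := q2; lra.
have fb : 0 <= b ^+ 2 + q - lam * b.
  have -> : b ^+ 2 + q - lam * b = q * (1 - (lam / d%:R) ^+ 2).
    by rewrite /b; field; rewrite gt_eqF.
  rewrite mulr_ge0 ?(ltW q0) // subr_ge0 expr_le1 // ?divr_ge0 ?(ltW lam0) ?(ltW d0) //.
  by rewrite ler_pdivrMr // mul1r.
have : 0 < (t - b) * (t + b - lam) by rewrite mulr_gt0 //; lra.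
nra.
Qed.

(** All characteristic roots other than that of the eigenvalue [d] are complex of
    modulus [sqrt q]. *)
Lemma nbrw_mixing_rate_small : 0 < lam -> lam ^+ 2 < 4 * q ->
  nbrw_mixing_rate R G = Num.sqrt q / q.
Proof.
move=> lam0 lq; have sq0 : 0 < Num.sqrt q by rewrite sqrtr_gt0.
have sqE : Num.sqrt q ^+ 2 = q by rewrite sqr_sqrtr // ltW.
apply/le_anti; rewrite nbrw_mixing_rate_le ?sqE //=; last first.
  rewrite -{2}sqE expr2 mulfK ?gt_eqF //.
  rewrite -(@ltr_pXn2r _ 2) ?nnegrE ?addr_ge0 ?ltW //.
  have -> : (Num.sqrt q + Num.sqrt q) ^+ 2 = 4 * Num.sqrt q ^+ 2 by ring.
  by rewrite sqE.
have [c c0 H] := nb_coef_oscillation q0 lq.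
apply: (nbrw_mixing_rate_ge sq0 c0) => x /eqP.
rewrite eqr_norml => /andP[/orP[]/eqP-> _] M; have [k Mk Hk] := H M; exists k => //.
by rewrite nb_coefN.
Qed.

End Rates.

(** * Closed walks and the second eigenvalue *)

(** The number of words with [i] down-steps and [n - i] up-steps all of whose
    prefixes have at least as many up-steps as down-steps. *)
Fixpoint ballot n i : nat :=
  if n is n'.+1 then
    if (i.*2 <= n)%N then (ballot n' i + (if i is j.+1 then ballot n' j else 0))%N
    else 0%N
  else (i == 0%N).

Lemma ballot_eq0 n i : (n < i.*2)%N -> ballot n i = 0%N.
Proof. by case: n i => [|n] [|i] //= H; rewrite leqNgt H. Qed.

Lemma ballot_bin n i : (i.+1.*2 <= n.+1)%N -> (ballot n i.+1 + 'C(n, i) = 'C(n, i.+1))%N.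
Proof.
have ballot0 m : ballot m 0 = 1%N by elim: m => //= m ->.
elim: n i => [|n IH] i Hi //.
have [Hi'|Hi'] := leqP i.+1.*2 n.+1; last first.
  rewrite ballot_eq0 // add0n -bin_sub; last by lia.
  by congr 'C(_, _); lia.
rewrite [ballot _ _]/= Hi' binS.
case: i Hi Hi' => [|i] Hi Hi'.
  by rewrite ballot0 bin0 -(IH 0%N) // bin0; lia.
rewrite binS -(IH i.+1) // -(IH i) //; lia.
Qed.

Definition catalan k := ballot k.*2 k.

Lemma mul_catalan k : (k.+1 * catalan k = 'C(k.*2, k))%N.
Proof.
case: k => [|k] //; rewrite /catalan.
have /eqP := ballot_bin (n := k.+1.*2) (i := k) (leqnSn _).
have := mul_bin_left k.+1.*2 k.
have -> : (k.+1.*2 - k = k.+2)%N by lia.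
set b := ballot _ _; set x := 'C(_, k); set y := 'C(_, _) => H1 /eqP H2; nia.
Qed.

Lemma catalan_rec k : (k.+2 * catalan k.+1 = 2 * k.*2.+1 * catalan k)%N.
Proof.
apply/eqP; rewrite -(eqn_pmul2l (ltn0Sn k)) mul_catalan; apply/eqP.
have E1 : 'C(k.+1.*2, k.+1) = (2 * 'C(k.*2.+1, k.+1))%N.
  rewrite doubleS binS -(@bin_sub k.*2.+1 k); last by lia.
  have -> : (k.*2.+1 - k = k.+1)%N by lia.
  lia.
have := mul_bin_diag k.*2.+1 k; rewrite /= -mul_catalan E1.
nia.
Qed.

(** By the recursion, consecutive Catalan numbers have ratio tending to [4], hence
    eventually above any [y < 4]. *)
Lemma catalan_growth (R : realType) (c : R) : 0 <= c -> c < 2 ->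
  exists2 k, (0 < k)%N & (c ^+ 2) ^+ k + 1 <= (catalan k)%:R.
Proof.
move=> c0 c2; pose a := Num.max 1 (c ^+ 2).
have a1 : 1 <= a by rewrite le_max lexx.
have ca : c ^+ 2 <= a by rewrite le_max lexx orbT.
have a4 : a < 4.
  by rewrite gt_max; apply/andP; split; [lra|nra].
pose y := (a + 4) / 2.
have ay : a < y by rewrite /y; lra.
have y4 : y < 4 by rewrite /y; lra.
pose K := (Num.truncn ((2 * y) / (4 - y))).+1.
have catS k : (K <= k)%N -> y * (catalan k)%:R <= (catalan k.+1)%:R.
  move=> Kk; have H : 2 * y < k%:R * (4 - y).
    rewrite -ltr_pdivrMr ?subr_gt0 //; apply: lt_le_trans (truncnS_gt _) _.
    by rewrite ler_nat.
  have k2 : 0 < k.+2%:R :> R by rewrite ltr0n.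
  rewrite -(ler_pM2l k2) -[leRHS]natrM catalan_rec natrM mulrA ler_wpM2r //.
  have -> : (2 * k.*2.+1)%:R = 4 * k%:R + 2 :> R.
    by rewrite -addn1 -mul2n !(natrM, natrD); ring.
  have -> : k.+2%:R = k%:R + 2 :> R by rewrite -addn2 natrD.
  lra.
have cat1 k : (0 < catalan k)%N.
  have := mul_catalan k; have : (0 < 'C(k.*2, k))%N by rewrite bin_gt0; lia.
  by case: (catalan k) => //; rewrite muln0 => H /esym H'; rewrite H' in H.
have catK j : y ^+ j <= (catalan (K + j))%:R.
  elim: j => [|j IH]; first by rewrite expr0 ler1n.
  rewrite addnS exprS; apply: le_trans (catS _ (leq_addr _ _)).
  by rewrite ler_wpM2l //; lra.
have [N HN] := @geometric_domination R a y (2 * a ^+ K) (le_trans ler01 a1) ay.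
exists (K + N)%N => //; apply: le_trans (catK N); apply: le_trans (HN N (leqnn N)).
rewrite -mulrA -exprD (mulr_natl _ 2) mulr2n lerD ?exprn_ege1 //.
by rewrite lerXn2r ?nnegrE ?sqr_ge0 // (le_trans ler01).
Qed.

Section UniversalCover.
Variables (G : sgraph) (d : nat).
Hypothesis d0 : (0 < d)%N.
Hypothesis Gd : regular d G.

Fixpoint walk_count k (u v : G) : nat :=
  if k is k'.+1 then \sum_w walk_count k' u w * adj w v else u == v.

(** The sum of the numbers of non-backtracking walks of lengths [k-1], [k-3], and so
    on.  Up to scaling these are the Chebyshev polynomials of the second kind in
    the adjacency matrix.  Shifting the index by one makes the three-term
    recurrence hold from the start, with no exceptional term. *)
Fixpoint nb_sum k (u v : G) : nat :=
  if k is k'.+1 then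
    if k' is k''.+1 then (nb_sum k'' u v + nb_count k' u v)%N else nb_count 0 u v
  else 0.

Lemma nb_sumS k u v : (\sum_w nb_sum k.+1 u w * adj w v =
  nb_sum k.+2 u v + d.-1 * nb_sum k u v)%N.
Proof.
pose P k := forall v, (\sum_w nb_sum k.+1 u w * adj w v =
  nb_sum k.+2 u v + d.-1 * nb_sum k u v)%N.
suff [] : P k /\ P k.+1 by [].
elim: k {v} => [|k [IH1 IH2]]; split=> // v.
- rewrite /= muln0 addn0 nb_count1.
  by under eq_bigr do rewrite nb_count0; rewrite sum_pred1.
- rewrite /= -nb_countSS (nb_count_edge0_backtrack Gd) nb_count0.
  by case: (u == v) => /=; lia.
- under eq_bigr do rewrite [nb_sum _ _ _]/= -/(nb_sum k.+1 u _) mulnDl.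
  rewrite big_split /= -/(nb_sum k.+1 u _) -nb_countSS (nb_count_edgeS_backtrack Gd).
  move: (IH1 v) => /= ->; lia.
Qed.

(** A walk of length [n] lifts to the universal cover, a tree; [i] is its number of
    steps that go down towards the root. *)
Lemma walk_countE n u v : walk_count n u v =
  (\sum_(i < n.+1) ballot n i * d.-1 ^ i * nb_sum (n.+1 - i.*2) u v)%N.
Proof.
elim: n v => [|n IH] v.
  by rewrite big_ord1 /= nb_count0 !mul1n.
rewrite [LHS]/=; under eq_bigr do rewrite IH big_distrl /=.
rewrite exchange_big /=.
pose T i := (ballot n i * d.-1 ^ i * nb_sum (n.+2 - i.*2) u v)%N.
pose T' i := (ballot n i * d.-1 ^ i.+1 * nb_sum (n - i.*2) u v)%N.
transitivity (\sum_(i < n.+1) (T i + T' i))%N.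
  apply: eq_bigr => i _; rewrite /T /T'.
  have [/ballot_eq0->|ni] := ltnP n i.*2; first by rewrite !mul0n big1.
  under eq_bigr do rewrite -mulnA.
  rewrite -big_distrr /= subSn // nb_sumS !subSn 1?leqW // expnS; lia.
have -> : (\sum_(i < n.+1) (T i + T' i) = \sum_(i < n.+2) T i + \sum_(i < n.+1) T' i)%N.
  rewrite big_split [in RHS]big_ord_recr /= [T n.+1]/T ballot_eq0; last by lia.
  by rewrite mul0n addn0.
rewrite big_ord_recl [in RHS]big_ord_recl -addnA -big_split; congr (_ + _)%N.
  by rewrite /T /= addn0.
apply: eq_bigr => i _; rewrite /T /T' lift0.
have -> : (n.+2 - i.+1.*2 = n - i.*2)%N by lia.
case: ifP => [_|/negbT Hi]; first by rewrite !mulnDl.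
(* The coefficient that is cut off multiplies nb_sum 0 = 0. *)
by have -> : (n - i.*2 = 0)%N; [lia|rewrite /= !muln0].
Qed.

(** Only the term with no net displacement is kept: closed walks that are already
    closed in the universal cover. *)
Lemma closed_walks_ge k u : (catalan k * d.-1 ^ k <= walk_count k.*2 u u)%N.
Proof.
have kk : (k < k.*2.+1)%N by lia.
rewrite walk_countE (bigD1 (Ordinal kk)) //= subSnn /= nb_count0 eqxx muln1.
exact: leq_addr.
Qed.

End UniversalCover.

Section AlonBoppana.
Variables (R : realType) (G : sgraph) (d : nat).
Hypothesis d3 : (3 <= d)%N.
Hypothesis Gd : regular d G.
Hypothesis Gc : connected G.

Lemma srw_prob_walk_count k (u v : G) :
  srw_prob R k u v = (walk_count k u v)%:R / d%:R ^+ k.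
Proof.
elim: k v => [|k IH] v /=; first by rewrite divr1.
rewrite natr_sum mulr_suml; apply: eq_bigr => w _.
by rewrite IH (Gd w) natrM exprSr invfM mulrACA.
Qed.

(** The diagonal entries of the projectors are nonnegative with sum [1], so a
    diagonal entry of a power of the adjacency matrix is an average of powers of
    eigenvalues, in which the eigenvalue [d] has weight [1 / n]. *)
Lemma closed_walks_le k (u : G) : (walk_count k.*2 u u)%:R <=
  second_eigenvalue R G ^+ k.*2 + d%:R ^+ k.*2 / #|G|%:R.
Proof.
have [D [E [i0 [Es ED E0 Enz [D0 Etop Eorth Dle _]]]]] :=
  graph_spectral_resolution R (ltnW d3) Gd Gc.
have dk0 : 0 < d%:R ^+ k.*2 :> R by rewrite exprn_gt0 // ltr0n; lia.
have -> : (walk_count k.*2 u u)%:R = srw_prob R k.*2 u u * d%:R ^+ k.*2.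
  by rewrite srw_prob_walk_count divfK ?gt_eqF.
have EM i x v := srw_prob_eigen Gd (ED i x) k.*2 v.
rewrite (kernel_expansion Es EM) mulr_suml.
have -> : \sum_i (D i / d%:R) ^+ k.*2 * E i u u * d%:R ^+ k.*2
   = \sum_i D i ^+ k.*2 * E i u u.
  apply: eq_bigr => i _; rewrite mulrAC expr_div_n divfK ?gt_eqF //.
rewrite (bigD1 i0) //= D0 Etop addrC lerD2r.
apply: (@le_trans _ _ (\sum_(i | i != i0) second_eigenvalue R G ^+ k.*2 * E i u u)).
  apply: ler_sum => i ii0; rewrite ler_wpM2r //.
  rewrite -mul2n !exprM; apply: lerXn2r; rewrite ?nnegrE ?sqr_ge0 //.
  rewrite -real_normK ?num_real // lerXn2r ?nnegrE ?normr_ge0 ?Dle //.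
  exact: le_trans (Dle i ii0).
have L0 : 0 <= second_eigenvalue R G ^+ k.*2 by rewrite -mul2n exprM exprn_ge0 ?sqr_ge0.
rewrite -mulr_sumr ler_piMr //.
have := Es u u; rewrite eqxx (bigD1 i0) //= => /(congr1 (fun x => x - E i0 u u)).
by rewrite addrAC subrr add0r => ->; rewrite gerBl.
Qed.

(** A form of the Alon-Boppana bound: closed walks seen in the tree cannot be
    accounted for by the eigenvalue [d] alone when [n] is large. *)
Lemma second_eigenvalue_catalan k : (d ^ k.*2 <= #|G|)%N ->
  ((catalan k)%:R - 1) * (d%:R - 1) ^+ k <= second_eigenvalue R G ^+ k.*2.
Proof.
move=> dn; have [/card_gt0P[u _] _] := Gc.
have n0 : 0 < #|G|%:R :> R by rewrite ltr0n; case: Gc.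
have q1 : 1 <= d%:R - 1 :> R.
  have : 3%:R <= d%:R :> R by rewrite ler_nat.
  lra.
have H := closed_walks_ge (ltnW (ltnW d3)) Gd k u.
have : (catalan k * d.-1 ^ k)%:R <= (walk_count k.*2 u u)%:R :> R by rewrite ler_nat.
rewrite natrM natrX -subn1 natrB; last by lia.
move=> /le_trans/(_ (closed_walks_le k u)).
have : d%:R ^+ k.*2 / #|G|%:R <= 1 :> R.
  by rewrite ler_pdivrMr // mul1r -natrX ler_nat.
have := exprn_ege1 k q1; lra.
Qed.

End AlonBoppana.

(** * Comparison of the mixing rates *)

Lemma second_eigenvalue_ge0 (R : realType) (G : sgraph) : 0 <= second_eigenvalue R G.
Proof. by rewrite /second_eigenvalue le_max normr_ge0 orbT. Qed.

(** The ratio is [(d / q) * (sqrt q / lam)], and [lam] is squeezed between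
    [2 / (1 + e) * sqrt q] and [2 * sqrt q]. *)
Lemma ratio_near_limit (R : realType) (G : sgraph) (d : nat) (e : R) :
  (3 <= d)%N -> regular d G -> connected G -> 0 < e ->
  2 / (1 + e) * Num.sqrt (d%:R - 1) <= second_eigenvalue R G ->
  second_eigenvalue R G < 2 * Num.sqrt (d%:R - 1) ->
  `|nbrw_mixing_rate R G / srw_mixing_rate R G - d%:R / (2 * (d%:R - 1))| < e.
Proof.
move=> d3 Gd Gc e0 lge llt.
have d3R : 3 <= d%:R :> R by rewrite ler_nat.
have q0 : 0 < d%:R - 1 :> R by lra.
set l := second_eigenvalue R G in lge llt *; set s := Num.sqrt _ in lge llt *.
have s0 : 0 < s by rewrite sqrtr_gt0.
have sE : s ^+ 2 = d%:R - 1 by rewrite sqr_sqrtr // ltW.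
have l0 : 0 < l by apply: lt_le_trans lge; rewrite mulr_gt0 // divr_gt0 //; lra.
have e1 : 0 < 1 + e by lra.
rewrite (nbrw_mixing_rate_small d3 Gd Gc) //; last first.
  rewrite -sE -/l (_ : 4 * s ^+ 2 = (2 * s) ^+ 2); last by ring.
  by rewrite ltr_pXn2r ?nnegrE ?mulr_ge0 // ltW.
rewrite (srw_mixing_rateE d3 Gd Gc) // -/l -/s.
have -> : s / (d%:R - 1) / (l / d%:R) - d%:R / (2 * (d%:R - 1))
    = d%:R / (d%:R - 1) * (s / l - 1 / 2).
  field; rewrite !gt_eqF //; lra.
have sl1 : 1 / 2 < s / l by rewrite ltr_pdivlMr //; lra.
have sl2 : s / l <= (1 + e) / 2.
  rewrite ler_pdivrMr //; move: lge; rewrite mulrAC ler_pdivrMr //; lra.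
have dq0 : 0 <= d%:R / (d%:R - 1) :> R by rewrite divr_ge0 // ltW.
have dq1 : d%:R / (d%:R - 1) <= 3 / 2 :> R by rewrite ler_pdivrMr //; lra.
rewrite ger0_norm; last by rewrite mulr_ge0 //; lra.
apply: (@le_lt_trans _ _ (3 / 2 * (e / 2))); last by lra.
by rewrite ler_pM //; lra.
Qed.

Theorem corollary1p2 (R : realType) :
  (forall (G : sgraph) (d : nat),
      (3 <= d)%N -> regular d G -> connected G -> ~ bipartite G ->
      2 * Num.sqrt (d%:R - 1) <= second_eigenvalue R G ->
      d%:R / (2 * (d%:R - 1)) <= nbrw_mixing_rate R G / srw_mixing_rate R G /\
      nbrw_mixing_rate R G / srw_mixing_rate R G <= 1) /\
  (forall (G : nat -> sgraph) (d : nat -> nat),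
      (forall i, (3 <= d i)%N) ->
      (forall i, regular (d i) (G i)) ->
      (forall i, connected (G i)) ->
      (forall i, ~ bipartite (G i)) ->
      (forall i, second_eigenvalue R (G i) < 2 * Num.sqrt ((d i)%:R - 1)) ->
      (fun i => #|G i|) @ \oo --> \oo ->
      (fun i => ln (d i)%:R / ln #|G i|%:R : R) @ \oo --> (0 : R) ->
      (fun i => nbrw_mixing_rate R (G i) / srw_mixing_rate R (G i)
                - (d i)%:R / (2 * ((d i)%:R - 1)) : R) @ \oo --> (0 : R)).
Proof.
split=> [G d d3 Gd Gc _ lge|G d d3 Gd Gc _ llt _ dn].
  have d3R : 3 <= d%:R :> R by rewrite ler_nat.
  have q0 : 0 < d%:R - 1 :> R by lra.
  have s0 : 0 < Num.sqrt (d%:R - 1) :> R by rewrite sqrtr_gt0.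
  have l0 : 0 < second_eigenvalue R G by lra.
  have lq : 4 * (d%:R - 1) <= second_eigenvalue R G ^+ 2.
    rewrite -[X in 4 * X]sqr_sqrtr ?(ltW q0) //.
    rewrite (_ : 4 * _ ^+ 2 = (2 * Num.sqrt (d%:R - 1)) ^+ 2).
      by rewrite lerXn2r ?nnegrE ?mulr_ge0 // ltW.
    by ring.
  have r0 : 0 < second_eigenvalue R G / d%:R by rewrite divr_gt0 //; lra.
  rewrite (srw_mixing_rateE d3 Gd Gc l0) ler_pdivlMr // ler_pdivrMr // mul1r; split.
    apply: le_trans (nbrw_mixing_rate_large_ge d3 Gd Gc lq l0).
    rewrite le_eqVlt; apply/orP; left; apply/eqP; field; rewrite !gt_eqF //; lra.
  exact: nbrw_mixing_rate_large_le.
apply/cvgrPdist_lt => e e0.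
(* This c makes sqrt q / lam exceed 1/2 by at most e/2 once lam >= c sqrt q. *)
pose c : R := 2 / (1 + e).
have c0 : 0 < c by rewrite divr_gt0 //; lra.
have c2 : c < 2 by rewrite ltr_pdivrMr; lra.
have [k k0 kP] := catalan_growth (ltW c0) c2.
have k0R : 0 < k.*2%:R^-1 :> R by rewrite invr_gt0 ltr0n double_gt0.
have dn_small : \forall i \near \oo,
    `|ln (d i)%:R / ln #|G i|%:R| < k.*2%:R^-1 :> R by exact: cvgr0_norm_lt.
near=> i.
have dni : `|ln (d i)%:R / ln #|G i|%:R| < k.*2%:R^-1 :> R.
  by near: i; exact: dn_small.
rewrite sub0r normrN; apply: ratio_near_limit => //.
have n1 : 1 < #|G i|%:R :> R by rewrite ltr1n; exact: card_gt1 (ltnW (d3 i)) (Gd i) (Gc i).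
(* The hypothesis on the degrees leaves room for the 2k-th power of d. *)
have dn_le : (d i ^ k.*2 <= #|G i|)%N.
  have di0 : 0 < (d i)%:R :> R by rewrite ltr0n; exact: leq_trans (d3 i).
  rewrite -(ler_nat R) natrX -ler_ln ?posrE ?exprn_gt0 ?(lt_trans ltr01 n1) //.
  rewrite lnXn // -[leLHS]mulr_natr -ler_pdivlMr ?ltr0n ?double_gt0 //.
  move: (le_lt_trans (ler_norm _) dni); rewrite ltr_pdivrMr ?ln_gt0 // => /ltW.
  by rewrite mulrC.
have := second_eigenvalue_catalan R (d3 i) (Gd i) (Gc i) dn_le.
have q0 : 0 < (d i)%:R - 1 :> R.
  have : 3 <= (d i)%:R :> R by rewrite ler_nat.
  by lra.
move=> H; rewrite -/c -(@ler_pXn2r _ k.*2) ?double_gt0 ?nnegrE ?second_eigenvalue_ge0 //.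
  apply: le_trans H; rewrite -mul2n exprM [X in X ^+ k]exprMn.
  rewrite sqr_sqrtr ?(ltW q0) // exprMn.
  by rewrite ler_wpM2r ?exprn_ge0 ?(ltW q0) // lerBrDr.
by rewrite mulr_ge0 ?(ltW c0) ?sqrtr_ge0.
Unshelve. all: by end_near.
Qed.
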